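(* Consider the system of flat connections $$\frac{\partial v_j^\alpha}{\partial x_i}+\sum_{\beta=1}^m v_i^\beta\frac{\partial v_j^\alpha}{\partial v^\beta}=\frac{\partial v_i^\alpha}{\partial x_j}+\sum_{\beta=1}^m v_j^\beta\frac{\partial v_i^\alpha}{\partial v^\beta},\qquad 1\le i<j\le n,\ \alpha=1,\dots,m,$$ for unknown functions $v_i^\alpha(x_1,\dots,x_n,v^1,\dots,v^m)$, with infinite prolongation $\mathcal{E}_{\mathrm{fc}}$. Any symmetry $(\varphi_i^\alpha)$, $i=1,\dots,n$, $\alpha=1,\dots,m$, of this system (given by its generating section, $\varphi_i^\alpha\in C^\infty(\mathcal{E}_{\mathrm{fc}})$) is of the form $$\varphi_i^\alpha=D_i(f^\alpha)-\sum_{\beta=1}^m v_i^{\alpha,\beta}f^\beta,\qquad v_i^{\alpha,\beta}=D_{v^\beta}(v_i^\alpha),$$ for arbitrary functions $f^\alpha\in C^\infty(\mathcal{E}_{\mathrm{fc}})$ (that is, every choice of $f^1,\dots,f^m$ gives a symmetry), and the functions $f^\alpha$ are uniquely determined by $(\varphi_i^\alpha)$.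
   Context: The independent variables are $x_1,\dots,x_n$ (in a coordinate chart $\mathcal{U}$ of the base $M$) and $v^1,\dots,v^m$ (coordinates on the fiber $\mathbb{R}^m$ of the trivial bundle $\mathcal{U}\times\mathbb{R}^m\to\mathcal{U}$); the dependent variables are $v_i^\alpha$. $\mathcal{E}_{\mathrm{fc}}$ is the submanifold of the infinite jet space (jets of $(v_i^\alpha)$ as functions of $(x,v)$) defined by the system together with all its differential consequences. $C^\infty(\mathcal{E}_{\mathrm{fc}})$ is the algebra of restrictions of smooth functions depending on finite-order jets. $D_{x_i}$ and $D_{v^\alpha}$ are the total derivatives with respect to $x_i$ and $v^\alpha$, restricted to $\mathcal{E}_{\mathrm{fc}}$, and $D_i=D_{x_i}+\sum_{\beta}v_i^\beta D_{v^\beta}$. A (higher) symmetry of $\mathcal{E}_{\mathrm{fc}}$ is a vector field $S$ on $\mathcal{E}_{\mathrm{fc}}$ with $S(x_i)=S(v^\alpha)=0$ that commutes with all total derivatives $D_{x_i},D_{v^\alpha}$; its generating section is the tuple $\varphi_i^\alpha=S(v_i^\alpha)$, which determines $S$. Equivalently, $(\varphi_i^\alpha)$ is the generating section of a symmetry iff it satisfies the linearization of the system on $\mathcal{E}_{\mathrm{fc}}$.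
   Formalization: The formal theorem assumes n ≥ 2, so that the range 1 ≤ i < j ≤ n is nonempty; for n = 1 the system has no equations and the claim is false (for m = 1, φ = 1 is a symmetry that is not of the stated form). *)

(* Defs.v *)
From HB Require Import structures.
From mathcomp Require Import all_boot all_order all_algebra.
From mathcomp Require Import all_classical all_reals all_analysis.

Set Implicit Arguments.
Unset Strict Implicit.
Unset Printing Implicit Defensive.

Import Order.TTheory GRing.Theory Num.Theory.
Import numFieldNormedType.Exports.

Local Open Scope classical_set_scope.
Local Open Scope ring_scope.

(* [inl i] stands for x_i and [inr b] for v^b. *)
Definition indep (n m : nat) : finType := ('I_n + 'I_m)%type.

(* [(i, a, s)] stands for the derivative of v_i^a, taken [s c] times with
   respect to each independent variable [c]. *)
Definition depvar (n m : nat) : choiceType :=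
  ('I_n * 'I_m * {ffun indep n m -> nat})%type.

Definition jcoord (n m : nat) : choiceType := (indep n m + depvar n m)%type.

Definition xvar {n m} (i : 'I_n) : indep n m := inl i.
Definition vvar {n m} (b : 'I_m) : indep n m := inr b.

Definition vjet {n m} (i : 'I_n) (a : 'I_m) : depvar n m :=
  (i, a, [ffun=> 0%N]).

Definition raise {n m} (c : indep n m) (q : depvar n m) : depvar n m :=
  (q.1, [ffun d => (q.2 d + (d == c))%N]).

Definition jorder {n m} (c : jcoord n m) : nat :=
  match c with inl _ => 0%N | inr q => (\sum_d q.2 d)%N end.

Section Jets.
Variables (R : realType) (n m : nat).

(* The space of infinite jets over R^n x R^m, with the product topology. *)
Definition jet := {ptws jcoord n m -> R}.

Definition base (t : jet) : 'rV[R]_n := \row_i t (inl (xvar i)).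

Definition over (U : set 'rV[R]_n) : set jet := [set t | U (base t)].

Definition upd (t : jet) (c : jcoord n m) (r : R) : jet :=
  fun d => if d == c then r else t d.

Definition pder (c : jcoord n m) (F : jet -> R) : jet -> R :=
  fun t => derive1 (fun r : R => F (upd t c r)) (t c).

Definition iter_pder (l : seq (jcoord n m)) (F : jet -> R) : jet -> R :=
  foldr pder F l.

Definition finite_order (U : set 'rV[R]_n) (F : jet -> R) : Prop :=
  exists k : nat, forall t t' : jet, over U t -> over U t' ->
    (forall c, (jorder c <= k)%N -> t c = t' c) -> F t = F t'.

(* A function of finitely many coordinates is continuous for the product
   topology iff it is continuous as a function of these coordinates, so this is
   the usual C^oo regularity on the jet space of order [k].  Values of [F]
   outside of [over U] are irrelevant. *)
Definition smooth (U : set 'rV[R]_n) (F : jet -> R) : Prop :=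
  finite_order U F /\
  forall (l : seq (jcoord n m)) (t : jet), over U t ->
    {for t, continuous (iter_pder l F)} /\
    forall c, derivable (fun r : R => iter_pder l F (upd t c r)) (t c) 1.

(* For [F] of finite order, the sum has finitely many nonzero terms over [U]. *)
Definition tder (c : indep n m) (F : jet -> R) : jet -> R :=
  fun t => pder (inl c) F t +
    \sum_(q \in [set: depvar n m]) t (inr (raise c q)) * pder (inr q) F t.

Definition iter_tder (l : seq (indep n m)) (F : jet -> R) : jet -> R :=
  foldr tder F l.

Definition flat_eq (i j : 'I_n) (a : 'I_m) : jet -> R := fun t =>
  (t (inr (raise (xvar i) (vjet j a))) +
     \sum_(b < m) t (inr (vjet i b)) * t (inr (raise (vvar b) (vjet j a)))) -
  (t (inr (raise (xvar j) (vjet i a))) +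
     \sum_(b < m) t (inr (vjet j b)) * t (inr (raise (vvar b) (vjet i a)))).

Definition Efc (U : set 'rV[R]_n) : set jet :=
  [set t | over U t /\
     forall (i j : 'I_n) (a : 'I_m) (l : seq (indep n m)),
       (i < j)%N -> iter_tder l (flat_eq i j a) t = 0].

Definition Epoint (U : set 'rV[R]_n) : Type := {t : jet | Efc U t}.

Section OnE.
Variable U : set 'rV[R]_n.
Local Notation E := (Epoint U).

Definition extends (F : jet -> R) (g : E -> R) : Prop :=
  smooth U F /\ forall p : E, F (sval p) = g p.

Definition CinfE (g : E -> R) : Prop := exists F, extends F g.

Definition extension (g : E -> R) : jet -> R :=
  xget (fun=> 0) [set F | extends F g].

(* The total derivatives are tangent to [Efc U]: the restriction of [tder c F]
   depends only on that of [F], so the choice of the extension is immaterial. *)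
Definition tderE (c : indep n m) (g : E -> R) : E -> R :=
  fun p => tder c (extension g) (sval p).

Definition coordE (c : jcoord n m) : E -> R := fun p => sval p c.

Definition vE (i : 'I_n) (a : 'I_m) : E -> R := coordE (inr (vjet i a)).

(* Vector fields on [Efc U] are the derivations of the algebra [CinfE]. *)
Definition vector_field (S : (E -> R) -> (E -> R)) : Prop :=
  [/\ forall g, CinfE g -> CinfE (S g),
      forall (r : R) g h, CinfE g -> CinfE h ->
        S (fun p => r * g p + h p) = (fun p => r * S g p + S h p)
    & forall g h, CinfE g -> CinfE h ->
        S (fun p => g p * h p) = (fun p => S g p * h p + g p * S h p)].

Definition is_symmetry (S : (E -> R) -> (E -> R)) : Prop :=
  [/\ vector_field S,
      forall c : indep n m, S (coordE (inl c)) = (fun=> 0)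
    & forall (c : indep n m) g, CinfE g -> S (tderE c g) = tderE c (S g)].

Definition generating_section (phi : 'I_n -> 'I_m -> E -> R) : Prop :=
  exists S, is_symmetry S /\ forall i a, phi i a = S (vE i a).

Definition DE (i : 'I_n) (g : E -> R) : E -> R := fun p =>
  tderE (xvar i) g p + \sum_(b < m) vE i b p * tderE (vvar b) g p.

End OnE.
End Jets.

(* Main.v *)
(** Write [V = A^m], where [A] is the algebra of smooth functions on [Efc], let
    [br f g] be the bracket of the vertical fields [sum f^b D_{v^b}] and
    [sum g^b D_{v^b}], and put [nab i g = D_{x_i} g + br v_i g].  The system says
    that the [nab i] commute, the tuples in the theorem are the [nab i f], and
    every symmetry satisfies [nab i phi_j = nab j phi_i].

    Every [f] gives a symmetry [S_f], the field with components
    [D^s (nab i f)^a], once vector fields that satisfy the linearized system are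
    known to act on functions on [Efc].  For this, [Efc] is parametrized by the
    derivatives of [v_i] in which no [x_k] with [k < i] occurs, so that each such
    vector is the velocity of a curve in [Efc].

    Conversely [L_f = S_f + br f] commutes with all [nab i], and
    [f |-> L_f phi_i] is a differential operator.  Dividing it on the left by
    [nab 1] and using [nab 2 (L_f phi_1) = nab 1 (L_f phi_2)], one gets
    [L_f phi_1 = nab 1 (Q f)].  Modulo operators that factor through the [nab i],
    [Q] is an operator [Q0] without [D_{x_i}].  It turns out to be a derivation of
    the bracket, hence inner, as for Lie algebras of vector fields: the Euler
    field [(v^1, ..., v^m)] gives [g] with [Q0 f = br f g], and then
    [nab 1 g = phi_1].  No integration is involved, so that the topology of [U]
    plays no role. *)

Require Import Defs.
From HB Require Import structures.
From mathcomp Require Import all_boot all_order all_algebra.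
From mathcomp Require Import all_classical all_reals all_analysis.
From mathcomp Require Import ring lra.
Import Order.TTheory GRing.Theory Num.Theory.
Import numFieldNormedType.Exports.
Local Open Scope classical_set_scope.
Local Open Scope ring_scope.

Set Implicit Arguments.
Unset Strict Implicit.
Unset Printing Implicit Defensive.

(** * The bracket and the connection *)

(** The fields [S_f] serve as test operators: letting [f] vary turns an equation between functions
    on [Efc] into one between differential operators in [f], whose coefficients are compared by
    means of commutators with the coordinate functions. By the chain rule [S_f a] depends on [f]
    only through the [nab i f], so [f |-> S_f a] lies in the left ideal generated by the [nab i]. As
    the [nab i] commute, and [nab i] has commutator 1 with [x_i] and 0 with the other [x_j], every
    operator is congruent modulo this ideal to exactly one that commutes with all [x_j]. Hence an
    identity between operators without [D_{x_j}] holds once it holds modulo the ideal, where [L_f]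
    may be replaced by [br f]. In the same way [nab i] is injective: if [nab i g = 0], then
    [nab i (L_f g) = 0] for all [f], so [L_f g = 0] by comparing leading coefficients in [D_{x_i}],
    and [br f g = 0] follows. This algebra is done over an abstract ring with commuting derivations,
    coordinate functions and inverses of the positive integers. *)

Definition derivation (A : pzRingType) (d : A -> A) : Prop :=
  (forall a b, d (a + b) = d a + d b) /\
  (forall a b, d (a * b) = d a * b + a * d b).

Section Derivation.
Variables (A : comPzRingType) (d : A -> A).
Hypothesis d_der : derivation d.

Lemma derD a b : d (a + b) = d a + d b. Proof. exact: d_der.1. Qed.

Lemma derM a b : d (a * b) = d a * b + a * d b. Proof. exact: d_der.2. Qed.

Lemma der0 : d 0 = 0.
Proof. by apply: (addrI (d 0)); rewrite -derD !addr0. Qed.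

Lemma derN a : d (- a) = - d a.
Proof. by apply: (addrI (d a)); rewrite -derD !subrr der0. Qed.

Lemma derB a b : d (a - b) = d a - d b.
Proof. by rewrite derD derN. Qed.

Lemma der1 : d 1 = 0.
Proof.
by apply: (addrI (d 1)); rewrite addr0 -{3}[1]mulr1 derM mulr1 mul1r.
Qed.

Lemma der_nat k : d k%:R = 0.
Proof. by elim: k => [|k IH]; rewrite ?der0 // -natr1 derD IH der1 addr0. Qed.

Lemma der_sum (I : Type) (r : seq I) (F : I -> A) :
  d (\sum_(i <- r) F i) = \sum_(i <- r) d (F i).
Proof.
elim: r => [|i r IH]; first by rewrite !big_nil der0.
by rewrite !big_cons derD IH.
Qed.

End Derivation.

Lemma vaddE (T : Type) (A : zmodType) (f g : T -> A) k : (f + g) k = f k + g k.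
Proof. by []. Qed.

Lemma voppE (T : Type) (A : zmodType) (f : T -> A) k : (- f) k = - f k.
Proof. by []. Qed.

Section Bracket.
Variables (A : comPzRingType) (n m : nat) (D : indep n m -> A -> A).
Hypothesis D_der : forall c, derivation (D c).
Hypothesis DC : forall c d a, D c (D d a) = D d (D c a).
Implicit Types (f g h : 'I_m -> A) (a b : A).

Definition dir f a : A := \sum_(k < m) f k * D (vvar k) a.

(* Locked: otherwise rewriting unfolds it to a difference of functions. *)
Definition br f g : 'I_m -> A :=
  locked (fun k => dir f (g k) - dir g (f k)).

Lemma brE f g k : br f g k = dir f (g k) - dir g (f k).
Proof. by rewrite /br -lock. Qed.

Definition mapD (d : A -> A) f : 'I_m -> A := fun k => d (f k).

Lemma dirDl f g a : dir (f + g) a = dir f a + dir g a.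
Proof. by rewrite /dir -big_split; apply: eq_bigr => k _; rewrite mulrDl. Qed.

Lemma dirNl f a : dir (- f) a = - dir f a.
Proof. by rewrite /dir -sumrN; apply: eq_bigr => k _; rewrite mulNr. Qed.

Lemma dir_der f : derivation (dir f).
Proof.
split=> a b.
  by rewrite /dir -big_split; apply: eq_bigr => k _; rewrite (derD (D_der _)) mulrDr.
rewrite /dir mulr_suml mulr_sumr -big_split; apply: eq_bigr => k _ /=.
by rewrite (derM (D_der _)); ring.
Qed.

Lemma dirZl a f b : dir (fun k => a * f k) b = a * dir f b.
Proof. by rewrite /dir mulr_sumr; apply: eq_bigr => k _; rewrite mulrA. Qed.

Lemma der_dir d f a : derivation d -> (forall c b, d (D c b) = D c (d b)) ->
  d (dir f a) = dir (mapD d f) a + dir f (d a).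
Proof.
move=> dd dC; rewrite /dir (der_sum dd) -big_split; apply: eq_bigr => k _ /=.
by rewrite (derM dd) dC.
Qed.

(** The second order terms are symmetric in [f] and [g] because the [D c] commute. *)
Lemma dir_comm f g a :
  dir f (dir g a) - dir g (dir f a) = dir (br f g) a.
Proof.
have e f' g' : dir f' (dir g' a) = \sum_(k < m) dir f' (g' k) * D (vvar k) a
    + \sum_(k < m) \sum_(l < m) f' l * g' k * D (vvar l) (D (vvar k) a).
  rewrite {2}/dir (der_sum (dir_der f')) -big_split; apply: eq_bigr => k _ /=.
  rewrite (derM (dir_der f')) {3}/dir mulr_sumr; congr (_ + _).
  by apply: eq_bigr => l _; ring.
rewrite !e /dir.
under [in RHS]eq_bigr do rewrite brE mulrBl.
rewrite sumrB -/(dir f _) -/(dir g _); rewrite /dir.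
rewrite [X in _ + X - _]exchange_big /=.
under [X in _ + X - _]eq_bigr do under eq_bigr do rewrite mulrC (DC (vvar _)) mulrC.
set x := \sum_(_ < m) _; set y := \sum_(_ < m) _; set z := \sum_(_ < m) _.
set w := \sum_(_ < m) _.
suff -> : y = w by rewrite opprD addrACA subrr addr0.
by apply: eq_bigr => k _; apply: eq_bigr => l _; congr (_ * _); rewrite mulrC.
Qed.

Lemma br_anti f g : br f g = - br g f.
Proof. by apply/funext => k; rewrite voppE !brE opprB. Qed.

Lemma brDl f g h : br (f + g) h = br f h + br g h.
Proof.
apply/funext => k; rewrite vaddE !brE dirDl vaddE (derD (dir_der _)); ring.
Qed.

Lemma brDr f g h : br h (f + g) = br h f + br h g.
Proof. by rewrite br_anti brDl opprD -!br_anti. Qed.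

Lemma brNl f g : br (- f) g = - br f g.
Proof.
by apply/funext => k; rewrite voppE !brE dirNl voppE (derN (dir_der _)) -opprD.
Qed.

Lemma brNr f g : br f (- g) = - br f g.
Proof. by rewrite br_anti brNl -br_anti. Qed.

Lemma br0l f : br 0 f = 0.
Proof. by apply: (addrI (br 0 f)); rewrite -brDl !addr0. Qed.

(** The bracket has constant coefficients in the [D c], so a derivation that commutes with them
    obeys the Leibniz rule. It is applied both to the [D_{x_i}] and to the symmetries. *)
Lemma br_der d f g : derivation d -> (forall c b, d (D c b) = D c (d b)) ->
  mapD d (br f g) = br (mapD d f) g + br f (mapD d g).
Proof.
move=> dd dC; apply/funext => k.
rewrite /mapD brE (derB dd) !(der_dir _ _ dd dC) -/(mapD d f) -/(mapD d g).
by rewrite vaddE !brE /mapD; ring.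
Qed.

Lemma br_jacobi f g h : br f (br g h) = br (br f g) h + br g (br f h).
Proof.
apply/funext => k; rewrite vaddE !brE -!dir_comm !(derB (dir_der _)); ring.
Qed.

Lemma mapDD d f g : derivation d -> mapD d (f + g) = mapD d f + mapD d g.
Proof. by move=> dd; apply/funext => k; rewrite /mapD (derD dd). Qed.

Lemma mapDN d f : derivation d -> mapD d (- f) = - mapD d f.
Proof. by move=> dd; apply/funext => k; rewrite /mapD (derN dd). Qed.

(** * The connection and its curvature *)

Section Connection.
Variable v : 'I_n -> 'I_m -> A.

Definition nab i f : 'I_m -> A := mapD (D (xvar i)) f + br (v i) f.

Definition curv i j : 'I_m -> A :=
  mapD (D (xvar i)) (v j) - mapD (D (xvar j)) (v i) + br (v i) (v j).

Lemma nabD i f g : nab i (f + g) = nab i f + nab i g.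
Proof. by rewrite /nab (mapDD _ _ (D_der _)) brDr addrACA. Qed.

Lemma nab_zero i : nab i 0 = 0.
Proof. by apply: (addrI (nab i 0)); rewrite -nabD // !addr0. Qed.

Lemma nabN i f : nab i (- f) = - nab i f.
Proof. by rewrite /nab (mapDN _ (D_der _)) brNr opprD. Qed.

Lemma nab_br i f g : nab i (br f g) = br (nab i f) g + br f (nab i g).
Proof.
rewrite /nab br_der // br_jacobi !brDl !brDr.
by apply/funext => k; rewrite !(vaddE, voppE); ring.
Qed.

Lemma nab_comm i j f : nab i (nab j f) - nab j (nab i f) = br (curv i j) f.
Proof.
rewrite /nab !mapDD // !br_der // !brDr /curv !brDl brNl (br_jacobi (v i)).
have -> : mapD (D (xvar i)) (mapD (D (xvar j)) f) =
          mapD (D (xvar j)) (mapD (D (xvar i)) f).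
  by apply/funext => k; rewrite /mapD DC.
by apply/funext => k; rewrite !(vaddE, voppE); ring.
Qed.

Lemma curv_anti i j : curv i j = - curv j i.
Proof.
rewrite /curv (br_anti (v j)).
by apply/funext => k; rewrite !(vaddE, voppE); ring.
Qed.

Lemma curv_diag i : curv i i = 0.
Proof. by rewrite /curv subrr add0r; apply/funext => k; rewrite brE subrr. Qed.

(** The Bianchi identity: it provides the compatibility conditions of the system when formal
    solutions are built in [sol_flat]. *)
Lemma bianchi i j k : nab k (curv i j) + nab i (curv j k) + nab j (curv k i) = 0.
Proof.
rewrite /nab /curv !mapDD // !mapDN // !br_der // !brDr !brNr (br_jacobi (v k)).
rewrite (br_anti (br (v k) (v i))) (br_anti (v k) (v j)) brNr.
rewrite !(br_anti (mapD _ _) (v _)).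
have e p q f : mapD (D (xvar p)) (mapD (D (xvar q)) f) =
          mapD (D (xvar q)) (mapD (D (xvar p)) f).
  by apply/funext => l; rewrite /mapD DC.
rewrite (e k i) (e i j) (e j k).
apply/funext => l; rewrite !(vaddE, voppE) -[RHS]/(0 : A); ring.
Qed.

End Connection.
End Bracket.

(** * Differential operators *)

Section Operators.
Variables (A : comPzRingType) (n m : nat) (D : indep n m -> A -> A).
Hypothesis D_der : forall c, derivation (D c).
Hypothesis DC : forall c d a, D c (D d a) = D d (D c a).
Variable xc : indep n m -> A.
Hypothesis D_xc : forall c d, D c (xc d) = (c == d)%:R.
Hypothesis natinv : forall k, exists a : A, k.+1%:R * a = 1.
Local Notation V := ('I_m -> A).
Implicit Types (f g h : V) (a b : A) (c d : indep n m) (P Q : V -> A).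

Lemma natmul_inj k a : k.+1%:R * a = 0 -> a = 0.
Proof.
by have [b kb] := natinv k => ka; rewrite -[a]mul1r -kb mulrAC ka mul0r.
Qed.

Definition smul a f : V := fun k => a * f k.

Definition Dw (l : seq (indep n m)) a : A := foldr D a l.

Lemma Dw_rcons l c a : Dw (rcons l c) a = D c (Dw l a).
Proof. by elim: l => //= d l ->; rewrite DC. Qed.

(** The formal derivative of the operator [P] with respect to [D c], taken as a commutator so that
    it depends on [P] as a map and not on the way it is written. *)
Definition ad c P : V -> A := fun f => P (smul (xc c) f) - xc c * P f.

(* Differential operators of order at most [N]. *)
Inductive dop N : (V -> A) -> Prop :=
| dop0 : dop N (fun=> 0)
| dopS a l k P : (size l <= N)%N -> dop N P ->
    dop N (fun f => a * Dw l (f k) + P f).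

Lemma dop_ext N P Q : dop N P -> P =1 Q -> dop N Q.
Proof. by move=> dP /funext <-. Qed.

Lemma dop_le N M P : (N <= M)%N -> dop N P -> dop M P.
Proof.
move=> NM; elim=> [|a l k {}P sl _ IH]; first exact: dop0.
exact: dopS (leq_trans sl NM) IH.
Qed.

Lemma dopD N P Q : dop N P -> dop N Q -> dop N (fun f => P f + Q f).
Proof.
move=> dP dQ; elim: dP => [|a l k {}P sl _ IH].
  by apply: dop_ext dQ _ => f; rewrite add0r.
by apply: dop_ext (dopS a k sl IH) _ => f; rewrite addrA.
Qed.

Lemma dopM N a P : dop N P -> dop N (fun f => a * P f).
Proof.
elim=> [|b l k {}P sl _ IH].
  by apply: dop_ext (dop0 N) _ => f; rewrite mulr0.
by apply: dop_ext (dopS (a * b) k sl IH) _ => f; rewrite mulrDr mulrA.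
Qed.

Lemma dopN N P : dop N P -> dop N (fun f => - P f).
Proof. by move=> /(dopM (-1)) dP; apply: dop_ext dP _ => f; rewrite mulN1r. Qed.

Lemma dopB N P Q : dop N P -> dop N Q -> dop N (fun f => P f - Q f).
Proof. by move=> dP /dopN; apply: dopD. Qed.

Lemma dop_sum N (I : Type) (r : seq I) (F : I -> V -> A) :
  (forall i, dop N (F i)) -> dop N (fun f => \sum_(i <- r) F i f).
Proof.
move=> dF; elim: r => [|i r IH].
  by apply: dop_ext (dop0 N) _ => f; rewrite big_nil.
by apply: dop_ext (dopD (dF i) IH) _ => f; rewrite big_cons.
Qed.

Lemma dop_coord N k : dop N (fun f => f k).
Proof.
apply: dop_ext (dopS (l := [::]) 1 k _ (dop0 N)) _ => // f.
by rewrite addr0 mul1r.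
Qed.

Lemma dop_D N c P : dop N P -> dop N.+1 (fun f => D c (P f)).
Proof.
elim=> [|a l k {}P sl _ IH].
  by apply: dop_ext (dop0 _) _ => f; rewrite (der0 (D_der c)).
have sl' : (size l <= N.+1)%N by exact: leqW.
apply: dop_ext (dopS (l := c :: l) a k _ (dopS (D c a) k sl' IH)) _ => // f.
by rewrite /= (derD (D_der c)) (derM (D_der c)); ring.
Qed.

Lemma dop_comp N M P (G : V -> V) : dop N P ->
  (forall k, dop M (fun f => G f k)) -> dop (N + M) (fun f => P (G f)).
Proof.
move=> + dG; elim=> [|a l k {}P sl _ IH]; first exact: dop0.
apply: dopD IH; apply: dopM.
apply: (@dop_le (size l + M)); first by rewrite leq_add2r.
by elim: l {sl} => [|c l IH] //=; rewrite addSn; apply: dop_D.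
Qed.

Lemma DwD l a b : Dw l (a + b) = Dw l a + Dw l b.
Proof. by elim: l => //= c l ->; rewrite (derD (D_der c)). Qed.

Lemma dop_additive N P f g : dop N P -> P (f + g) = P f + P g.
Proof.
by elim=> [|a l k {}P _ _ ->]; rewrite ?addr0 // vaddE DwD; ring.
Qed.

(** The words obtained from [l] by deleting one occurrence of [c], in all possible ways: the
    derivative of the monomial [Dw l] with respect to [D c]. *)
Fixpoint adw c (l : seq (indep n m)) : seq (seq (indep n m)) :=
  if l is d :: l' then
    (if d == c then [:: l'] else [::]) ++ map (cons d) (adw c l')
  else [::].

Lemma Dw_xc c l a : Dw l (xc c * a) =
  xc c * Dw l a + \sum_(w <- adw c l) Dw w a.
Proof.
elim: l => [|d l IH] /=; first by rewrite big_nil addr0.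
rewrite IH (derD (D_der d)) (derM (D_der d)) D_xc big_cat big_map /=.
rewrite (der_sum (D_der d)).
case: eqP => _; rewrite ?big_seq1 ?big_nil /=; ring.
Qed.

Lemma size_adw c l w : w \in adw c l -> (size w).+1 = size l.
Proof.
elim: l w => //= d l IH w; rewrite mem_cat => /orP[|/mapP[w' /IH <- ->]] //.
by case: eqP; rewrite // inE => _ /eqP ->.
Qed.

Lemma dop_seq N k (ws : seq (seq (indep n m))) :
  (forall w, w \in ws -> (size w <= N)%N) ->
  dop N (fun f => \sum_(w <- ws) Dw w (f k)).
Proof.
elim: ws => [|w ws IH] sw.
  by apply: dop_ext (dop0 N) _ => f; rewrite big_nil.
apply: dop_ext (dopS 1 k (sw w _) (IH _)) _ => [|w' w'ws|f].
- by rewrite inE eqxx.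
- by apply: sw; rewrite inE w'ws orbT.
- by rewrite big_cons mul1r.
Qed.

Lemma ad_mono c a l k P f : ad c (fun f => a * Dw l (f k) + P f) f =
  a * (\sum_(w <- adw c l) Dw w (f k)) + ad c P f.
Proof. by rewrite /ad Dw_xc; ring. Qed.

Lemma dop_ad N c P : dop N.+1 P -> dop N (ad c P).
Proof.
elim=> [|a l k {}P sl _ IH].
  by apply: dop_ext (dop0 N) _ => f; rewrite /ad mulr0 subr0.
apply: dop_ext (dopD (dopM a (dop_seq (ws := adw c l) k _)) IH) _ => [w|f].
  by move=> /size_adw ws; rewrite -ltnS ws.
by rewrite ad_mono.
Qed.

Lemma dop0_lin P f : dop 0 P ->
  P f = \sum_k f k * P (fun j => (j == k)%:R).
Proof.
elim=> [|a l k {}P sl _ IH]; first by rewrite big1 // => k _; rewrite mulr0.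
case: l sl => // _ /=; rewrite IH.
under [RHS]eq_bigr do rewrite mulrDr.
rewrite big_split /=; congr (_ + _).
rewrite (bigD1 k) //= eqxx big1 => [|j jk]; first by rewrite addr0 mulr1 mulrC.
by rewrite eq_sym (negPf jk) !mulr0.
Qed.

Lemma ad_dop0 c P f : dop 0 P -> ad c P f = 0.
Proof.
move=> dP; rewrite /ad !(dop0_lin _ dP) mulr_sumr -sumrB big1 // => k _.
by rewrite /smul; ring.
Qed.

(** The Euler operator on symbols: a monomial of order [k] is multiplied by [k]. As it is built from
    commutators, it detects the order of an operator without any normal form. *)
Definition eul P : V -> A := fun f => \sum_c ad c P (mapD (D c) f).

Lemma sum_adw l a :
  \sum_c \sum_(w <- adw c l) Dw w (D c a) = (size l)%:R * Dw l a.
Proof.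
elim: l => [|d l IH] /=.
  by rewrite mul0r big1 // => c _; rewrite big_nil.
under eq_bigr do rewrite big_cat big_map /=.
rewrite big_split /= (bigD1 d) //= eqxx big_seq1 big1 ?addr0; last first.
  by move=> c cd; rewrite eq_sym (negPf cd) big_nil.
rewrite -{1}[D d a]/(Dw [:: d] a) {1}/Dw -foldr_cat cats1 -/(Dw _ a) Dw_rcons.
under eq_bigr do rewrite -(der_sum (D_der d)).
rewrite -(der_sum (D_der d)) IH (derM (D_der d)) (der_nat (D_der d)).
by rewrite -natr1; ring.
Qed.

Lemma eul_mono a l k P f : eul (fun f => a * Dw l (f k) + P f) f =
  (size l)%:R * (a * Dw l (f k)) + eul P f.
Proof.
rewrite /eul; under eq_bigr do rewrite ad_mono.
by rewrite big_split -mulr_sumr sum_adw; congr (_ + _); ring.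
Qed.

Lemma eul_dop N P : dop N.+1 P ->
  exists2 Q, dop N Q & forall f, eul P f = N.+1%:R * P f + Q f.
Proof.
elim=> [|a l k {}P sl _ [Q dQ eQ]].
  exists (fun=> 0); first exact: dop0.
  by move=> f; rewrite mulr0 addr0 /eul big1 // => c _; rewrite /ad mulr0 subr0.
move: sl; rewrite leq_eqVlt => /orP[/eqP sl|sl].
  by exists Q => // f; rewrite eul_mono sl eQ; ring.
exists (fun f => ((size l)%:R - N.+1%:R) * a * Dw l (f k) + Q f).
  exact: dopS.
by move=> f; rewrite eul_mono eQ; ring.
Qed.

(** If [eul P = 0], then [eul_dop] expresses [N.+1] times [P] by an operator of order [N], so the
    order drops step by step to zero. *)
Lemma eul_eq0 N P : dop N P -> (forall f, eul P f = 0) ->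
  forall f, P f = \sum_k f k * P (fun j => (j == k)%:R).
Proof.
elim: N P => [|N IH] P dP eP f; first exact: dop0_lin.
have [Q dQ eQ] := eul_dop dP; apply: IH => //.
have [a Na] := natinv N.
apply: dop_ext (dopM (- a) dQ) _ => g.
have -> : Q g = - (N.+1%:R * P g) by move: (eQ g); rewrite eP => /esym /addr0_eq <-.
by rewrite mulrNN mulrCA mulrA Na mul1r.
Qed.

End Operators.

(** * Exactness of closed tuples *)

Section Cohomology.
Variables (A : comPzRingType) (n m : nat) (D : indep n m -> A -> A).
Hypothesis D_der : forall c, derivation (D c).
Hypothesis DC : forall c d a, D c (D d a) = D d (D c a).
Variable xc : indep n m -> A.
Hypothesis D_xc : forall c d, D c (xc d) = (c == d)%:R.
Hypothesis natinv : forall k, exists a : A, k.+1%:R * a = 1.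
Variable v : 'I_n -> 'I_m -> A.
Hypothesis flat : forall i j, curv D v i j = 0.
Local Notation V := ('I_m -> A).
Local Notation br := (br D).
Local Notation nab := (nab D v).
Local Notation dop := (dop D).
Local Notation adx i := (ad xc (xvar i)).
Local Notation x i := (xc (xvar i)).
Implicit Types (f g h : V) (a b : A) (P Q : V -> A).

Lemma nabC i j f : nab i (nab j f) = nab j (nab i f).
Proof.
apply/eqP; by rewrite -subr_eq0 (nab_comm D_der DC) flat br0l.
Qed.

Lemma dir_x f i : dir D f (x i) = 0.
Proof. by rewrite /dir big1 // => k _; rewrite D_xc mulr0. Qed.

Lemma br_xl i f g : br (smul (x i) f) g = smul (x i) (br f g).
Proof.
apply/funext => k; rewrite /smul !brE dirZl (derM (dir_der D_der _)) dir_x; ring.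
Qed.

Lemma br_xr i f g : br g (smul (x i) f) = smul (x i) (br g f).
Proof.
rewrite br_anti br_xl (br_anti _ g).
by apply/funext => k; rewrite /smul !voppE mulrN.
Qed.

Lemma nab_x i j f :
  nab i (smul (x j) f) = smul (x j) (nab i f) + smul (i == j)%:R f.
Proof.
apply/funext => k; rewrite /nab /smul !vaddE.
have := congr1 (fun F => F k) (br_xr j f (v i)); rewrite /smul => ->.
rewrite /mapD (derM (D_der _)) D_xc.
by rewrite -[xvar i == xvar j]/(i == j); ring.
Qed.

Lemma nab0 i : nab i 0 = 0.
Proof. exact: nab_zero. Qed.

Lemma natinv_const k : exists2 a : A, k.+1%:R * a = 1 & forall c, D c a = 0.
Proof.
have [a ka] := natinv k; exists a => // c; apply: (natmul_inj natinv (k := k)).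
have := congr1 (D c) ka.
by rewrite (derM (D_der c)) (der_nat (D_der c)) mul0r add0r (der1 (D_der c)).
Qed.

(** * Operators of arbitrary order and division by [nab i] *)

Definition isdop P := exists N, dop N P.

Lemma isdop_ext P Q : isdop P -> P =1 Q -> isdop Q.
Proof. by move=> dP /funext <-. Qed.

Lemma isdopD P Q : isdop P -> isdop Q -> isdop (fun f => P f + Q f).
Proof.
move=> [N dP] [M dQ]; exists (maxn N M); apply: dopD.
- exact: dop_le (leq_maxl _ _) dP.
- exact: dop_le (leq_maxr _ _) dQ.
Qed.

Lemma isdopM a P : isdop P -> isdop (fun f => a * P f).
Proof. by move=> [N dP]; exists N; apply: dopM. Qed.

Lemma isdopB P Q : isdop P -> isdop Q -> isdop (fun f => P f - Q f).
Proof.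
move=> dP /(isdopM (-1)) dQ; apply: isdop_ext (isdopD dP dQ) _ => f.
by rewrite mulN1r.
Qed.

Lemma isdopDer c P : isdop P -> isdop (fun f => D c (P f)).
Proof. by move=> [N dP]; exists N.+1; apply: dop_D. Qed.

Lemma isdop_sum (I : Type) (r : seq I) (F : I -> V -> A) :
  (forall i, isdop (F i)) -> isdop (fun f => \sum_(i <- r) F i f).
Proof.
move=> dF; elim: r => [|i r IH].
  by apply: isdop_ext (ex_intro _ 0%N (dop0 D 0)) _ => f; rewrite big_nil.
by apply: isdop_ext (isdopD (dF i) IH) _ => f; rewrite big_cons.
Qed.

Definition vdop (P : V -> V) := forall k, isdop (fun f => P f k).

Lemma vdop_bound (P : V -> V) : vdop P ->
  exists N, forall k, dop N (fun f => P f k).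
Proof.
move=> /choice[N dP]; exists (\max_k N k)%N => k.
exact: dop_le (leq_bigmax k) (dP k).
Qed.

Lemma vdop_id : vdop id.
Proof. by move=> k; exists 0%N; apply: dop_coord. Qed.

Lemma vdopD (P Q : V -> V) : vdop P -> vdop Q -> vdop (fun f => P f + Q f).
Proof. by move=> dP dQ k; apply: isdopD. Qed.

Lemma vdopB (P Q : V -> V) : vdop P -> vdop Q -> vdop (fun f => P f - Q f).
Proof. by move=> dP dQ k; apply: isdopB. Qed.

Lemma isdop_comp P (G : V -> V) : isdop P -> vdop G -> isdop (fun f => P (G f)).
Proof.
by move=> [N dP] /vdop_bound[M dG]; exists (N + M)%N; apply: dop_comp.
Qed.

Lemma isdop_dirl (P : V -> V) a : vdop P -> isdop (fun f => dir D (P f) a).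
Proof.
move=> dP; apply: isdop_sum => k.
by apply: isdop_ext (isdopM (D (vvar k) a) (dP k)) _ => f; rewrite mulrC.
Qed.

Lemma isdop_dirr P f : isdop P -> isdop (fun g => dir D f (P g)).
Proof. by move=> dP; apply: isdop_sum => k; apply/isdopM/isdopDer. Qed.

Lemma vdop_brl (P : V -> V) g : vdop P -> vdop (fun f => br (P f) g).
Proof.
move=> dP k; apply: isdop_ext (isdopB (isdop_dirl (g k) dP) (isdop_dirr g (dP k))) _.
by move=> f; rewrite brE.
Qed.

Lemma vdop_brr (P : V -> V) g : vdop P -> vdop (fun f => br g (P f)).
Proof.
move=> /vdop_brl-/(_ g) dP k; apply: isdop_ext (isdopM (-1) (dP k)) _ => f.
by rewrite (br_anti _ g) voppE mulN1r.
Qed.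

Lemma vdop_nab i (P : V -> V) : vdop P -> vdop (fun f => nab i (P f)).
Proof.
move=> dP; apply: vdopD; last exact: vdop_brr.
by move=> k; apply: isdopDer.
Qed.

Definition vadx i (P : V -> V) : V -> V :=
  fun f => P (smul (x i) f) - smul (x i) (P f).

Lemma vadxE i (P : V -> V) f k : vadx i P f k = adx i (fun g => P g k) f.
Proof. by []. Qed.

Lemma vdop_adx i (P : V -> V) : vdop P -> vdop (vadx i P).
Proof.
move=> dP k; have [N /(dop_le (leqnSn N)) dPk] := dP k.
by exists N; apply: (dop_ad D_der D_xc (xvar i) dPk).
Qed.

Lemma vadx_nilN i N (P : V -> V) : (forall k, dop N (fun f => P f k)) ->
  forall f, iter N.+1 (vadx i) P f = 0.
Proof.
elim: N P => [|N IH] P dP f.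
  by apply/funext => k; rewrite /= vadxE (ad_dop0 _ _ _ (dP k)).
rewrite iterSr; apply: IH => k.
exact: (dop_ad D_der D_xc (xvar i) (dP k)).
Qed.

Lemma vadx_nil i (P : V -> V) : vdop P ->
  exists N, forall f, iter N (vadx i) P f = 0.
Proof. by move=> /vdop_bound[N dP]; exists N.+1; apply: vadx_nilN. Qed.

Lemma vadx_nab i (P Q : V -> V) f :
  vadx i (fun g => nab i (P g) + Q g) f =
  nab i (vadx i P f) + (P f + vadx i Q f).
Proof.
rewrite /vadx nabD // nabN // nab_x eqxx.
by apply/funext => k; rewrite /smul !(vaddE, voppE) mulr1n; ring.
Qed.

Lemma vadx_mul i (P : V -> V) K f :
  vadx i (fun g => smul K%:R (P g)) f = smul K%:R (vadx i P f).
Proof. by apply/funext => k; rewrite /vadx /smul !(vaddE, voppE); ring. Qed.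

Lemma vadx_iterB i (P Q : V -> V) N f :
  iter N (vadx i) (fun g => P g - Q g) f =
  iter N (vadx i) P f - iter N (vadx i) Q f.
Proof.
elim: N f => // N IH f; rewrite !iterS; have -> := funext IH.
by apply/funext => k; rewrite /vadx /smul !(vaddE, voppE); ring.
Qed.

Lemma vadx_iterM i (P : V -> V) a N f :
  iter N (vadx i) (fun g => smul a (P g)) f = smul a (iter N (vadx i) P f).
Proof.
elim: N f => // N IH f; rewrite !iterS; have -> := funext IH.
by apply/funext => k; rewrite /vadx /smul !(vaddE, voppE); ring.
Qed.

(** The commutator of [nab i] with [x_i] is the identity, so this is the Leibniz rule for an
    iterated derivation. *)
Lemma vadx_iter_nab i (P : V -> V) K f :
  iter K.+1 (vadx i) (fun g => nab i (P g)) f =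
  nab i (iter K.+1 (vadx i) P f) + smul K.+1%:R (iter K (vadx i) P f).
Proof.
elim: K f => [|K IH] f; rewrite iterS.
  have := vadx_nab i P (fun=> 0) f.
  have -> : (fun g => nab i (P g) + 0) = (fun g => nab i (P g)).
    by apply/funext => g; rewrite addr0.
  move=> ->; congr (_ + _).
  apply/funext => k; rewrite /vadx /smul !(vaddE, voppE).
  by change ((0 : V) k) with (0 : A); rewrite /=; ring.
have -> := funext IH; rewrite vadx_nab vadx_mul -iterS; congr (_ + _).
by apply/funext => k; rewrite /smul vaddE -!natr1 iterS; ring.
Qed.

(* The top coefficient of [nab i o P] in [D_{x_i}] is that of [P]. *)
Lemma nab_inj i (P : V -> V) : vdop P ->
  (forall f, vadx i (fun g => nab i (P g)) f = 0) -> forall f, P f = 0.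
Proof.
move=> /vadx_nil-/(_ i)[N]; elim: N => // N IH PN aP f; apply: (IH _ aP) => {}f.
have : iter N.+1 (vadx i) (fun g => nab i (P g)) f = 0.
  rewrite iterSr; have -> : vadx i (fun g => nab i (P g)) = (fun=> 0).
    by apply/funext => g; rewrite aP.
  elim: (N) f => // M IHM g; rewrite iterS /vadx !IHM sub0r.
  by apply/funext => k; rewrite voppE /smul -[0 k]/(0 : A) mulr0 oppr0.
rewrite vadx_iter_nab PN nab0 add0r => e; apply/funext => k.
apply: (natmul_inj natinv (k := N)).
by move/(congr1 (fun F => F k)): e.
Qed.

(** Euclidean division on the left by [nab i], which is monic of degree one in [D_{x_i}]; the degree
    of [P] is measured by the power of [vadx i] that kills it. *)
Lemma nab_div i (P : V -> V) : vdop P -> exists Q P0 : V -> V,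
  [/\ vdop Q, vdop P0, forall f, vadx i P0 f = 0 &
      forall f, P f = nab i (Q f) + P0 f].
Proof.
move=> dP; have [N] := vadx_nil i dP; elim: N P dP => [|N IH] P dP PN.
  exists (fun=> 0), (fun=> 0); split=> [k|k|f|f].
  - exact: ex_intro (dop0 D 0).
  - exact: ex_intro (dop0 D 0).
  - by apply/funext => k; rewrite /vadx /smul !(vaddE, voppE) mulr0 subr0.
  - by rewrite nab0 addr0 -[P f]/(iter 0 (vadx i) P f).
have [N0|Npos] := posnP N.
  exists (fun=> 0), P; split=> // [k|f|f].
  - exact: ex_intro (dop0 D 0).
  - by have := PN f; rewrite N0.
  - by rewrite nab0 add0r.
case: N Npos => // N _ in IH PN *.
have [a Na a0] := natinv_const N.
(* [P] has degree at most [N.+1] in [D_{x_i}]. Deriving by [D_{x_i}], dividing by [N.+1] and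
   multiplying by [nab i] restores its coefficient of that degree. *)
pose P1 f := smul a (vadx i P f).
have dP1 : vdop P1 by move=> k; apply/isdopM/(vdop_adx i dP).
pose P' f := P f - nab i (P1 f).
have dP' : vdop P' by apply: vdopB => //; apply: vdop_nab.
have P'N f : iter N.+1 (vadx i) P' f = 0.
  rewrite vadx_iterB vadx_iter_nab.
  have P1i M g : iter M (vadx i) P1 g = smul a (iter M.+1 (vadx i) P g).
    by rewrite iterSr vadx_iterM.
  rewrite !P1i PN; apply/funext => k.
  rewrite !(vaddE, voppE) /smul mulrA Na mul1r.
  have -> : (fun l => a * (0 : V) l) = 0.
    by apply/funext => l; rewrite -[0 l]/(0 : A) mulr0.
  by rewrite nab0 add0r subrr.
have [Q [P0 [dQ dP0 aP0 eP]]] := IH P' dP' P'N.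
exists (fun f => Q f + P1 f), P0; split=> // [|f]; first exact: vdopD.
by rewrite nabD // addrAC -eP /P' subrK.
Qed.

(** * The left ideal generated by the [nab i] and its complement *)

Definition inI P := exists (N : nat) (R : 'I_n -> V -> A),
  (forall i, dop N (R i)) /\ forall f, P f = \sum_i R i (nab i f).

Lemma inI_ext P Q : inI P -> P =1 Q -> inI Q.
Proof. by move=> dP /funext <-. Qed.

Lemma inI0 : inI (fun=> 0).
Proof.
exists 0%N, (fun _ _ => 0); split=> [i|f]; first exact: dop0.
by rewrite big1.
Qed.

Lemma inID P Q : inI P -> inI Q -> inI (fun f => P f + Q f).
Proof.
move=> [N [R [dR eP]]] [M [R' [dR' eQ]]].
exists (maxn N M), (fun i f => R i f + R' i f); split=> [i|f].
  by apply: dopD; [exact: dop_le (leq_maxl _ _) (dR i) |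
                   exact: dop_le (leq_maxr _ _) (dR' i)].
by rewrite eP eQ big_split.
Qed.

Lemma inIM a P : inI P -> inI (fun f => a * P f).
Proof.
move=> [N [R [dR eP]]]; exists N, (fun i f => a * R i f); split=> [i|f].
  exact: dopM.
by rewrite eP mulr_sumr.
Qed.

Lemma inIB P Q : inI P -> inI Q -> inI (fun f => P f - Q f).
Proof.
move=> iP /(inIM (-1)) iQ; apply: inI_ext (inID iP iQ) _ => f.
by rewrite mulN1r.
Qed.

Lemma inIDer c P : inI P -> inI (fun f => D c (P f)).
Proof.
move=> [N [R [dR eP]]]; exists N.+1, (fun i f => D c (R i f)).
split=> [i|f]; first exact: dop_D.
by rewrite eP (der_sum (D_der c)).
Qed.

Lemma inI_sum (I : Type) (r : seq I) (F : I -> V -> A) :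
  (forall i, inI (F i)) -> inI (fun f => \sum_(i <- r) F i f).
Proof.
move=> dF; elim: r => [|i r IH].
  by apply: inI_ext inI0 _ => f; rewrite big_nil.
by apply: inI_ext (inID (dF i) IH) _ => f; rewrite big_cons.
Qed.

Lemma inI_nab i P : isdop P -> inI (fun f => P (nab i f)).
Proof.
move=> [N dP]; exists N, (fun j => if j == i then P else fun=> 0).
split=> [j|f]; first by case: eqP => // _; exact: dop0.
rewrite (bigD1 i) //= eqxx big1 ?addr0 // => j /negPf ji.
by rewrite ji.
Qed.

Lemma inI_isdop P : inI P -> isdop P.
Proof.
move=> [N [R [dR eP]]].
apply: (@isdop_ext (fun f => \sum_i R i (nab i f))) => [|f]; last by rewrite eP.
apply: isdop_sum => i; apply: isdop_comp; first by exists N; apply: dR.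
exact: (vdop_nab i vdop_id).
Qed.

Lemma inI_dirr P f : inI P -> inI (fun g => dir D f (P g)).
Proof. by move=> iP; apply: inI_sum => k; apply/inIM/inIDer. Qed.

Definition vinI (P : V -> V) := forall k, inI (fun f => P f k).

Lemma inI_dirl (P : V -> V) a : vinI P -> inI (fun f => dir D (P f) a).
Proof.
move=> iP; apply: inI_sum => k.
by apply: inI_ext (inIM (D (vvar k) a) (iP k)) _ => f; rewrite mulrC.
Qed.

Lemma vinI_brl (P : V -> V) g : vinI P -> vinI (fun f => br (P f) g).
Proof.
move=> iP k; apply: inI_ext (inIB (inI_dirl (g k) iP) (inI_dirr g (iP k))) _.
by move=> f; rewrite brE.
Qed.

Lemma vinI_brr (P : V -> V) g : vinI P -> vinI (fun f => br g (P f)).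
Proof.
move=> /vinI_brl-/(_ g) iP k; apply: inI_ext (inIM (-1) (iP k)) _ => f.
by rewrite (br_anti _ g) voppE mulN1r.
Qed.

Lemma vinI_nab i (P : V -> V) : vinI P -> vinI (fun f => nab i (P f)).
Proof.
move=> iP k; apply: (inID (inIDer (xvar i) (iP k))).
exact: (vinI_brr (v i) iP k).
Qed.

Lemma inI_dop P (G : V -> V) : isdop P -> vinI G -> inI (fun f => P (G f)).
Proof.
move=> [N dP] iG; elim: dP => [|a l k {}P _ _ IH]; first exact: inI0.
apply: inID IH; apply: inIM.
by elim: l => [|c l IH] //=; apply: inIDer.
Qed.

(** The Euler operator for the degree in the [D_{x_i}] alone. Having [nab i] in place of [D_{x_i}]
    puts its values into the ideal and changes it only in lower degree. *)
Definition eulx P : V -> A := fun f => \sum_i adx i P (nab i f).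

(* [P] has degree at most [N] in the [D_{x_i}] jointly; degree 0 means that [P]
   commutes with multiplication by the [x_i]. *)
Fixpoint Gx N P := if N is N'.+1 then forall i, Gx N' (adx i P)
                   else forall i f, adx i P f = 0.

Lemma dop_Gx N P : dop N P -> Gx N P.
Proof.
elim: N P => [|N IH] P dP i; first by move=> f; apply: ad_dop0 dP.
by apply/IH/(dop_ad D_der D_xc).
Qed.

Lemma GxM N a P : Gx N P -> Gx N (fun f => a * P f).
Proof.
have e i Q : adx i (fun f => a * Q f) = (fun f => a * adx i Q f).
  by apply/funext => f; rewrite /ad; ring.
elim: N P => [|N IH] P gP i; first by move=> f; rewrite e gP mulr0.
by rewrite e; apply: IH.
Qed.

Lemma ad_additive i P : (forall f g, P (f + g) = P f + P g) ->
  forall f g, adx i P (f + g) = adx i P f + adx i P g.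
Proof.
move=> aP f g; rewrite /ad.
have -> : smul (x i) (f + g) = smul (x i) f + smul (x i) g.
  by apply/funext => k; rewrite vaddE /smul mulrDr.
by rewrite !aP; ring.
Qed.

Lemma smulC a b f : smul a (smul b f) = smul b (smul a f).
Proof. by apply/funext => k; rewrite /smul mulrCA. Qed.

Lemma adxC i j P f : adx i (adx j P) f = adx j (adx i P) f.
Proof. by rewrite /ad smulC; ring. Qed.

Lemma smul_delta (P : V -> A) (b : bool) f :
  P 0 = 0 -> P (smul b%:R f) = b%:R * P f.
Proof.
case: b => P0; first by rewrite mul1r; congr P; apply/funext => k; rewrite /smul mul1r.
rewrite mul0r -P0; congr P.
by apply/funext => k; rewrite /smul mul0r.
Qed.

Lemma adx_eulx j P f : (forall f g, P (f + g) = P f + P g) ->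
  adx j (eulx P) f = eulx (adx j P) f + adx j P f.
Proof.
move=> aP; rewrite {1}/ad /eulx mulr_sumr -sumrB.
have aP0 i : adx i P 0 = 0.
  by apply: (addrI (adx i P 0)); rewrite -ad_additive // !addr0.
under eq_bigr => i _.
  rewrite nab_x ad_additive // (smul_delta _ _ (aP0 i)) addrAC -/(ad _ _ _ _).
  rewrite -[X in X + _]/(adx j (adx i P) (nab i f)) adxC.
  over.
rewrite big_split /=; congr (_ + _).
rewrite (bigD1 j) //= eqxx mul1r big1 ?addr0 // => i /negPf ->.
by rewrite mul0r.
Qed.

Lemma eulx_Gx N P : (forall f g, P (f + g) = P f + P g) -> Gx N.+1 P ->
  Gx N (fun f => eulx P f - N.+1%:R * P f).
Proof.
elim: N P => [|N IH] P aP gP i.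
  move=> f; rewrite /ad; have := adx_eulx i f aP.
  rewrite {2}/eulx big1 => [|j _]; last exact: gP.
  by rewrite /ad => /eqP; rewrite add0r subr_eq => /eqP ->; ring.
have -> : adx i (fun f => eulx P f - N.+2%:R * P f) =
          fun f => eulx (adx i P) f - N.+1%:R * adx i P f.
  apply/funext => f; have := adx_eulx i f aP; rewrite {1 3 4}/ad => /eqP.
  by rewrite subr_eq => /eqP; rewrite /ad => ->; rewrite -(natr1 N.+1); ring.
by apply: IH; [exact: ad_additive | exact: gP].
Qed.

Lemma isdop_additive P : isdop P -> forall f g, P (f + g) = P f + P g.
Proof. by move=> [N dP] f g; apply: dop_additive dP. Qed.

Lemma isdop_adx i P : isdop P -> isdop (adx i P).
Proof.
by move=> [N dP]; exists N; apply/(dop_ad D_der D_xc)/(dop_le (leqnSn N)).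
Qed.

Lemma isdop_eulx P : isdop P -> isdop (eulx P).
Proof.
move=> dP; apply: isdop_sum => i; apply: isdop_comp; first exact: isdop_adx.
exact: (vdop_nab i vdop_id).
Qed.

Lemma inI_eulx P : isdop P -> inI (eulx P).
Proof. by move=> dP; apply: inI_sum => i; apply/inI_nab/isdop_adx. Qed.

(** Up to lower degree in the [D_{x_i}], [P] is [eulx P] divided by its degree, and [eulx P] lies in
    the ideal. *)
Lemma inI_dec P : isdop P ->
  exists P0, [/\ isdop P0, Gx 0 P0 & inI (fun f => P f - P0 f)].
Proof.
move=> [M dP]; have gP := dop_Gx dP.
have {dP} : isdop P by exists M.
elim: M P gP => [|N IH] P gP dP.
  by exists P; split=> //; apply: inI_ext inI0 _ => f; rewrite subrr.
have [|Q0 [dQ gQ iQ]] := IH _ (eulx_Gx (isdop_additive dP) gP).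
  by apply: isdopB; [exact: isdop_eulx | exact: isdopM].
have [a Na] := natinv N.
exists (fun f => - a * Q0 f); split; [exact: isdopM|exact: GxM|].
apply: inI_ext (inIM a (inIB (inI_eulx dP) iQ)) _ => f.
transitivity (N.+1%:R * a * P f + a * Q0 f); last by rewrite Na; ring.
by ring.
Qed.

(** Flatness enters here: [nab j (nab i f)] has to be rewritten as [nab i (nab j f)] to recover
    [eulx (R j)] at [nab j f]. *)
Lemma eulx_inI (R : 'I_n -> V -> A) f : (forall i, isdop (R i)) ->
  eulx (fun f => \sum_i R i (nab i f)) f =
  \sum_i eulx (R i) (nab i f) + \sum_i R i (nab i f).
Proof.
move=> dR; rewrite /eulx [X in _ = X + _]exchange_big -big_split; apply: eq_bigr => j _ /=.
rewrite /ad mulr_sumr -sumrB.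
have aR i := isdop_additive (dR i).
have R0 i : R i 0 = 0 by apply: (addrI (R i 0)); rewrite -aR !addr0.
under [LHS]eq_bigr => i _.
  rewrite nab_x aR smul_delta // (nabC i j) addrAC.
  over.
rewrite big_split /=; congr (_ + _).
rewrite (bigD1 j) //= eqxx mul1r big1 ?addr0 // => i /negPf ->.
by rewrite mul0r.
Qed.

(** Here [eulx P = 0], so [eulx_inI] expresses [P] by the [eulx (R i)]. This writes a multiple of
    [P] with cofactors of lower degree; for cofactors of degree 0 it says that [P] vanishes. *)
Lemma inI_cap P : inI P -> Gx 0 P -> forall f, P f = 0.
Proof.
move=> [N [R [dR]]]; have gR i := dop_Gx (dR i).
have {dR} : forall i, isdop (R i) by move=> i; exists N.
elim: N P R gR => [|N IH] P R gR dR eP gP f.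
  have := eulx_inI f dR; have -> := esym (funext eP).
  rewrite /eulx big1 => [|i _]; last exact: gP.
  rewrite big1 ?add0r -?eP // => i _; rewrite big1 // => j _; exact: gR.
(* The factor [N.+2] is the 1 from [eulx_inI] plus the [N.+1] from [eulx_Gx]. *)
apply: (natmul_inj natinv (k := N.+1)).
have := @IH (fun f => N.+2%:R * P f)
  (fun i f => -1 * (eulx (R i) f - N.+1%:R * R i f)).
apply=> [i|i|g|].
- exact/GxM/eulx_Gx/gR/isdop_additive.
- by apply/isdopM/isdopB; [exact: isdop_eulx | exact: isdopM].
- have := eulx_inI g dR; have <- := funext eP.
  rewrite {1}/eulx big1 => [|i _]; last exact: gP.
  move/esym/eqP; rewrite addr_eq0 => /eqP e.
  rewrite -mulr_sumr sumrB e -mulr_sumr -eP -natr1; ring.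
- exact: (@GxM 0).
Qed.

(** * The symmetries [S f] as test operators *)

Variable S : V -> A -> A.
Hypothesis S_der : forall f, derivation (S f).
Hypothesis S_D : forall f c a, S f (D c a) = D c (S f a).
Hypothesis S_v : forall f i, mapD (S f) (v i) = nab i f.
Hypothesis S_inI : forall a, inI (fun f => S f a).

Definition unitv (b : 'I_m) : V := fun k => (k == b)%:R.
Definition fibv : V := fun k => xc (vvar k).

Lemma br_unitv (b : 'I_m) h : br (unitv b) h = mapD (D (vvar b)) h.
Proof.
apply/funext => k; rewrite brE /mapD /dir (bigD1 b) //= /unitv eqxx mul1r.
rewrite big1 => [|l /negPf ->]; last by rewrite mul0r.
by rewrite big1 ?addr0 ?subr0 // => l _; rewrite der_nat // mulr0.
Qed.

Lemma dir_fibv f k : dir D f (fibv k) = f k.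
Proof.
rewrite /dir (bigD1 k) //= D_xc eqxx mulr1 big1 ?addr0 // => l /negPf lk.
by rewrite D_xc -[vvar l == vvar k]/(l == k) lk mulr0.
Qed.

Lemma br_fibv h k : br fibv h k = dir D fibv (h k) - h k.
Proof. by rewrite brE dir_fibv. Qed.

(** Brackets with the constant fields show that [g] is constant along the fibre; the bracket of the
    Euler field with [g] is then [- g]. *)
Lemma br_nondeg g : (forall f, br f g = 0) -> g = 0.
Proof.
move=> g0; apply/funext => k.
have := congr1 (fun F => F k) (g0 fibv); rewrite br_fibv /dir big1 => [|b _].
  by rewrite sub0r => /eqP; rewrite oppr_eq0 => /eqP.
have := congr1 (fun F => F k) (g0 (unitv b)); rewrite br_unitv /mapD => ->.
by rewrite -[0 k]/(0 : A) mulr0.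
Qed.

Definition lie f g : V := mapD (S f) g + br f g.

Lemma mapS_br f g h : mapD (S f) (br g h) =
  br (mapD (S f) g) h + br g (mapD (S f) h).
Proof. exact: br_der. Qed.

Lemma lie_br f g h : lie f (br g h) = br (lie f g) h + br g (lie f h).
Proof. by rewrite /lie mapS_br br_jacobi // brDl // brDr // addrACA. Qed.

(** [S f] moves [v i] by [nab i f], so it fails to commute with [nab i] by [br (nab i f)]; [br f]
    fails by the opposite amount. *)
Lemma lie_nab i f g : lie f (nab i g) = nab i (lie f g).
Proof.
have e : mapD (S f) (mapD (D (xvar i)) g) = mapD (D (xvar i)) (mapD (S f) g).
  by apply/funext => k; rewrite /mapD S_D.
rewrite /lie nabD // nab_br // {1 3}/nab mapDD // mapS_br S_v e.
by apply/funext => k; rewrite !vaddE; ring.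
Qed.

Lemma lie0 f : lie f 0 = 0.
Proof.
apply: (addrI (lie f 0)); rewrite addr0 /lie addrACA -mapDD // -brDr //.
by rewrite !addr0.
Qed.

Lemma vinI_S g : vinI (fun f => mapD (S f) g).
Proof. by move=> k; apply: S_inI. Qed.

Lemma vdop_lie g : vdop (fun f => lie f g).
Proof.
apply: vdopD; last exact: (vdop_brl g vdop_id).
by move=> k; apply/inI_isdop/S_inI.
Qed.

(** Identities between operators free of the [D_{x_i}] are reduced by this lemma to congruences
    modulo the ideal. *)
Lemma vinI_cap (T : V -> V) : vinI T ->
  (forall i f, T (smul (x i) f) = smul (x i) (T f)) -> forall f, T f = 0.
Proof.
move=> iT Tx f; apply/funext => k; apply: (inI_cap (iT k)) => i g.
by rewrite /ad Tx /smul subrr.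
Qed.

Lemma nab_ker i g : nab i g = 0 -> g = 0.
Proof.
move=> g0; apply: br_nondeg; apply: vinI_cap => [k|j f]; last exact: br_xl.
have l0 f : lie f g = 0.
  apply: (nab_inj (i := i) (vdop_lie g)) => {}f.
  by rewrite /vadx -!lie_nab g0 !lie0 sub0r; apply/funext => l;
    rewrite voppE /smul -[0 l]/(0 : A) mulr0 oppr0.
apply: inI_ext (inIM (-1) (S_inI (g k))) _ => f.
have := congr1 (fun F => F k) (l0 f); rewrite /lie vaddE /mapD => /addr0_eq <-.
by rewrite mulN1r.
Qed.

(** * Solving [nab i g = phi] for a closed pair *)

Section Closed.
Variables (i j : 'I_n) (phi psi : V).
Hypotheses (ij : i != j) (closed : nab j phi = nab i psi).

(** The remainder [P0] of the division vanishes. Closedness gives [nab j P0 = nab i R] with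
    [R g = lie g psi - nab j (Q g)]. The left side commutes with [x_i] because [i != j], so
    comparing leading coefficients yields [R = 0], and [nab j] is injective. *)
Lemma closed_div : exists2 Q : V -> V, vdop Q &
  forall f, lie f phi = nab i (Q f).
Proof.
have [Q [P0 [dQ dP0 xP0 eQ]]] := nab_div i (vdop_lie phi).
exists Q => // f.
have e g : nab j (P0 g) = nab i (lie g psi - nab j (Q g)).
  have := congr1 (nab j) (eQ g); rewrite -lie_nab closed lie_nab nabD //.
  by rewrite nabC => e; rewrite nabD // nabN // e addrAC subrr add0r.
have r0 : forall g, lie g psi - nab j (Q g) = 0.
  apply: (nab_inj (i := i)); first by apply: vdopB; [exact: vdop_lie | exact: vdop_nab].
  move=> g; have <- := funext e; rewrite /vadx.
  have := congr1 (nab j) (xP0 g); rewrite /vadx nabD // nabN // nab_x.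
  rewrite eq_sym (negPf ij) nab0 => <-; congr (_ - _).
  by apply/funext => k; rewrite vaddE /smul mul0r addr0.
have {}e g : nab j (P0 g) = 0 by rewrite e r0 nab0.
by rewrite eQ (nab_ker (e f)) addr0.
Qed.

(** [S f] commutes with the [D c], so in the difference only the coefficients of [P] are
    differentiated. This bounds the order in [f] independently of [h]. *)
Lemma S_comm_bound N P : dop N P ->
  exists M, forall h, dop M (fun f => S f (P h) - P (mapD (S f) h)).
Proof.
elim=> [|a l k {}P _ _ [M dM]].
  exists 0%N => h; apply: dop_ext (dop0 D 0) _ => f.
  by rewrite subr0 (der0 (S_der f)).
have [K dK] := inI_isdop (S_inI a); exists (maxn K M) => h.
have e f : S f (Dw D l (h k)) = Dw D l (S f (h k)).
  by elim: l => //= c l <-; rewrite S_D.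
apply: dop_ext (dopD (dop_le (leq_maxl K M) (dopM (Dw D l (h k)) dK))
                     (dop_le (leq_maxr K M) (dM h))) _ => f.
by rewrite (derD (S_der f)) (derM (S_der f)) e /mapD; ring.
Qed.

Lemma dop_dirl N (P : V -> V) a : (forall k, dop N (fun f => P f k)) ->
  dop N (fun f => dir D (P f) a).
Proof.
move=> dP; apply: dop_sum => k.
by apply: dop_ext (dopM (D (vvar k) a) (dP k)) _ => f; rewrite mulrC.
Qed.

Lemma dop_dirr N P h : dop N P -> dop N.+1 (fun f => dir D h (P f)).
Proof. by move=> dP; apply: dop_sum => k; apply/dopM/dop_D. Qed.

Lemma dop_brl N (P : V -> V) h k : (forall k, dop N (fun f => P f k)) ->
  dop N.+1 (fun f => br (P f) h k).
Proof.
move=> dP; apply: dop_ext (dopB (dop_le (leqnSn N) (dop_dirl (h k) dP))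
                               (dop_dirr h (dP k))) _ => f.
by rewrite brE.
Qed.

Lemma dop_brr N (P : V -> V) h k : (forall k, dop N (fun f => P f k)) ->
  dop N.+1 (fun f => br h (P f) k).
Proof.
move=> dP; apply: dop_ext (dopN (dop_brl h k dP)) _ => f.
by rewrite (br_anti _ h) voppE.
Qed.

Lemma vdop_add (P : V -> V) : vdop P -> forall f g, P (f + g) = P f + P g.
Proof.
by move=> dP f g; apply/funext => k; rewrite vaddE (isdop_additive (dP k)).
Qed.

Lemma vdop0 (P : V -> V) : vdop P -> P 0 = 0.
Proof.
by move=> dP; apply: (addrI (P 0)); rewrite -(vdop_add dP) !addr0.
Qed.

Lemma lie_add f g h : lie f (g + h) = lie f g + lie f h.
Proof. by rewrite /lie mapDD // brDr // addrACA. Qed.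

Lemma closed_exact : exists g, nab i g = phi.
Proof.
have [Q dQ eQ] := closed_div.
have [Q0t] := choice (fun k => inI_dec (dQ k)).
pose Q0 f : V := fun k => Q0t k f.
move=> Q0P.
have dQ0 : vdop Q0 by move=> k; case: (Q0P k).
have Q0x l f : Q0 (smul (x l) f) = smul (x l) (Q0 f).
  apply/funext => k; have [_ /(_ l f) gQ _] := Q0P k.
  by apply/eqP; rewrite -subr_eq0; apply/eqP.
have iQ0 : vinI (fun f => Q f - Q0 f).
  by move=> k; have [_ _] := Q0P k.
have Q0D := vdop_add dQ0.
(* Modulo the ideal, [lie f phi = nab i (Q f)] becomes [br f phi = nab i (Q0 f)]. The term
   [Q0 (nab i f)] lies in the ideal and is subtracted to make the left side commute with the
   [x_l]. *)
have step5 f : nab i (Q0 f) - Q0 (nab i f) = br f phi.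
  apply/eqP; rewrite -subr_eq0; apply/eqP.
  apply: (vinI_cap (T := fun f => nab i (Q0 f) - Q0 (nab i f) - br f phi)).
    move=> k; apply: inI_ext (inIB (inIB (vinI_S phi k) (vinI_nab i iQ0 k))
                                   (inI_nab i (dQ0 k))) _ => g.
    have := congr1 (fun F => F k) (eQ g).
    by rewrite /lie nabD // nabN // !(vaddE, voppE) => <-; ring.
  move=> l g; rewrite br_xl !nab_x Q0x nab_x Q0D Q0x.
  have -> : Q0 (smul (i == l)%:R g) = smul (i == l)%:R (Q0 g).
    by apply/funext => k; exact: (smul_delta _ _ (congr1 (fun F => F k) (vdop0 dQ0))).
  by apply/funext => k; rewrite /smul !(vaddE, voppE); ring.
(* [nab i] commutes with every [W f]; hence [W], as an operator in [f], has no
   leading coefficient in [D_{x_i}]. *)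
pose W f h : V := lie f (Q0 h) - Q0 (lie f h) - br h (Q f).
(* The commutator of [nab i] with [Q0] is [br _ phi] by [step5], and [lie f] turns [phi] into
   [nab i (Q f)]; the term [br h (Q f)] in [W] compensates exactly for this. *)
have W_nab f h : nab i (W f h) = W f (nab i h).
  have e g : nab i (Q0 g) = Q0 (nab i g) + br g phi.
    by rewrite -(step5 g) addrC subrK.
  have e1 : nab i (lie f (Q0 h)) = lie f (Q0 (nab i h)) + lie f (br h phi).
    by rewrite -lie_nab e lie_add.
  have e2 : nab i (Q0 (lie f h)) = Q0 (lie f (nab i h)) + br (lie f h) phi.
    by rewrite e -lie_nab.
  have e3 : nab i (br h (Q f)) = br (nab i h) (Q f) + br h (lie f phi).
    by rewrite nab_br // -eQ.
  rewrite /W nabD // nabN // nabD // nabN // e1 e2 e3 lie_br.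
  by apply/funext => k; rewrite !(vaddE, voppE); ring.
(* The bound has to be uniform in [h], since the next step replaces [h] by [nab i h]. *)
have [M dM] : exists M, forall h k, dop M (fun f => W f h k).
  have [M1 dQM] := vdop_bound dQ; have [M2 dQ0M] := vdop_bound dQ0.
  have /choice[M3 dSM] := fun k => S_comm_bound (dQ0M k).
  exists (maxn (\max_k M3 k) (maxn (M2 + 1) (maxn 1 M1.+1)))%N => h k.
  have le1 : (M3 k <= maxn (\max_k M3 k) (maxn (M2 + 1) (maxn 1 M1.+1)))%N.
    by rewrite leq_max leq_bigmax.
  have id1 l : dop 0 (fun f : V => f l) by apply: dop_coord.
  have d2 : dop 1 (fun f => br f (Q0 h) k) by apply: (dop_brl _ _ id1).
  have d3 : dop (M2 + 1) (fun f => Q0 (br f h) k).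
    by apply: (dop_comp D_der (dQ0M k)) => l; apply: (dop_brl _ _ id1).
  have d4 : dop M1.+1 (fun f => br h (Q f) k) by apply: dop_brr.
  apply: dop_ext (dopB (dopB (dopD (dop_le le1 (dSM k h)) (dop_le _ d2))
                             (dop_le _ d3)) (dop_le _ d4)) _ => [|||f].
  - by rewrite !leq_max leqnn !orbT.
  - by rewrite !leq_max leqnn !orbT.
  - by rewrite !leq_max leqnn !orbT.
  - by rewrite /W /lie Q0D !(vaddE, voppE) [mapD _ (Q0 h) k]/mapD /=; ring.
have W0 : forall h f, W f h = 0.
  have := fun h => vadx_nilN i (dM h).
  elim: M.+1 => // N IH WN; apply: IH => h f; apply/funext => k.
  have := vadx_iter_nab i (W^~ h) N f; rewrite WN nab0 add0r.
  have -> : (fun f => nab i (W f h)) = (W^~ (nab i h)).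
    by apply/funext => g; rewrite W_nab.
  rewrite WN => /(congr1 (fun F => F k)) /esym; exact: (natmul_inj natinv).
(* This is [W = 0] read modulo the ideal, with [lie f] replaced by [br f] and [Q] by [Q0]. *)
have Q0br h f : Q0 (br f h) = br f (Q0 h) + br (Q0 f) h.
  apply/esym/eqP; rewrite -subr_eq0; apply/eqP; rewrite (br_anti _ (Q0 f) h).
  apply: (vinI_cap (T := fun f => br f (Q0 h) - br h (Q0 f) - Q0 (br f h))).
    move=> k; apply: inI_ext (inIB (inI_dop (dQ0 k) (vinI_S h))
      (inIB (vinI_S (Q0 h) k) (vinI_brr h iQ0 k))) _ => g.
    have := congr1 (fun F => F k) (W0 h g).
    by rewrite /W /lie Q0D brDr // brNr // !(vaddE, voppE) => /eqP;
      rewrite subr_eq -[0 k]/(0 : A) add0r => /eqP <-; ring.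
  move=> l g; rewrite !br_xl !Q0x br_xr.
  by apply/funext => k; rewrite /smul !(vaddE, voppE); ring.
(* If [Q0 f = br f g] for all [f], then [D_{v^b} g = Q0 (unitv b)] and
   [g = dir fibv g - br fibv g]. *)
pose g : V := fun k => \sum_b fibv b * Q0 (unitv b) k - Q0 fibv k.
exists g.
have D0 c : D c 0 = 0 by apply: der0.
have unit_unit p q : br (unitv p) (unitv q) = 0.
  by apply/funext => k; rewrite br_unitv /mapD /unitv der_nat.
have unit_fib p : br (unitv p) fibv = unitv p.
  by apply/funext => k; rewrite br_unitv /mapD /fibv D_xc /unitv eq_sym.
have DQfib p k : D (vvar p) (Q0 fibv k) = dir D fibv (Q0 (unitv p) k).
  have := congr1 (fun F => F k) (Q0br fibv (unitv p)).
  rewrite unit_fib br_unitv (br_anti _ _ fibv) !(vaddE, voppE) br_fibv /mapD.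
  by move/eqP; rewrite opprB addrCA -subr_eq0 opprD addrA subrr add0r oppr_eq0
    subr_eq0 => /eqP.
have DQunit p q k : D (vvar p) (Q0 (unitv q) k) = D (vvar q) (Q0 (unitv p) k).
  have := congr1 (fun F => F k) (Q0br (unitv q) (unitv p)).
  rewrite unit_unit (vdop0 dQ0) br_unitv (br_anti _ _ (unitv q)) br_unitv.
  rewrite !(vaddE, voppE) /mapD => /esym/eqP.
  by rewrite subr_eq -[0 k]/(0 : A) add0r => /eqP.
have Dg p k : D (vvar p) (g k) = Q0 (unitv p) k.
  rewrite /g derB // der_sum // DQfib /dir.
  under eq_bigr do rewrite derM // DQunit.
  rewrite big_split /= addrK (bigD1 p) //= D_xc eqxx mul1r big1 ?addr0 //.
  by move=> q qp; rewrite D_xc -[vvar p == vvar q]/(p == q) eq_sym (negPf qp) mul0r.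
(* [Q'] is again a derivation of the bracket, and it kills the constant fields and the Euler field;
   this forces it to vanish. *)
pose Q' h : V := Q0 h - br h g.
have dQ' : vdop Q' by apply: vdopB => //; exact: (vdop_brl g vdop_id).
have Q'D := vdop_add dQ'.
have Q'br h f : Q' (br f h) = br f (Q' h) + br (Q' f) h.
  rewrite /Q' Q0br brDr // brDl // brNr // brNl //.
  rewrite (br_jacobi D_der DC f h g) (br_anti _ (br f g) h).
  by apply/funext => k; rewrite !(vaddE, voppE); ring.
have Q'unit p : Q' (unitv p) = 0.
  by apply/funext => k; rewrite /Q' br_unitv vaddE voppE /mapD Dg subrr.
have Q'fib : Q' fibv = 0.
  apply/funext => k; rewrite /Q' vaddE voppE br_fibv /dir.
  by under eq_bigr do rewrite Dg; rewrite {1}/g -[RHS]/(0 : A); ring.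
have Q'x l h : Q' (smul (x l) h) = smul (x l) (Q' h).
  rewrite /Q' br_xl Q0x.
  by apply/funext => k; rewrite /smul !(vaddE, voppE); ring.
have br0r h : br h 0 = 0 by rewrite br_anti br0l // oppr0.
have Q'D_ p h : Q' (mapD (D (vvar p)) h) = mapD (D (vvar p)) (Q' h).
  by rewrite -br_unitv Q'br Q'unit br0l // addr0 br_unitv.
(* [Q'] commutes with each [D_{v^q}], which is the bracket with a constant field, and with
   [dir D fibv], which is the bracket with the Euler field plus the identity. Their comparison is
   [eul Q' = 0], so [Q'] has order zero. *)
have Q'eul k h : eul D xc (fun f => Q' f k) h = 0.
  rewrite /eul big_sumType /= big1 ?add0r => [|l _]; last first.
    by rewrite /ad Q'x /smul subrr.
  have e f : (fun l => dir D fibv (f l)) = br fibv f + f.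
    by apply/funext => l; rewrite vaddE br_fibv subrK.
  have := congr1 Q' (e h); rewrite Q'D Q'br Q'fib br0l // addr0 -e.
  move/(congr1 (fun F => F k)) => /eqP; rewrite -subr_eq0 => /eqP {2}<-.
  have Qsum (I : finType) (F : I -> V) : Q' (\sum_i F i) = \sum_i Q' (F i).
    by elim/big_rec2: _ => [|q f f' _ <-]; [exact: vdop0 | rewrite Q'D].
  have -> : (fun l => dir D fibv (h l)) =
            \sum_q smul (xc (vvar q)) (mapD (D (vvar q)) h).
    by apply/funext => l; rewrite /dir fct_sumE.
  rewrite Qsum fct_sumE /dir -sumrB; apply: eq_bigr => q _.
  by rewrite /ad Q'D_.
have Q'0 h : Q' h = 0.
  apply/funext => k; have [N dN] := dQ' k.
  rewrite (eul_eq0 D_der DC D_xc natinv dN (Q'eul k)) big1 // => q _.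
  by rewrite -/(unitv q) Q'unit -[0 k]/(0 : A) mulr0.
(* With [Q0 f = br f g], [step5] and the Leibniz rule for [nab i] give [br h (nab i g) = br h phi]
   for all [h]. *)
apply/eqP; rewrite -subr_eq0; apply/eqP/br_nondeg => h.
have Q0E f : Q0 f = br f g by apply/eqP; rewrite -subr_eq0; apply/eqP/Q'0.
have := step5 h; rewrite !Q0E nab_br // addrC addKr => e.
by rewrite brDr // brNr // e subrr.
Qed.

End Closed.

(** Two directions determine [g]. For any other [i], closedness puts [nab i g - phi i] into the
    kernel of [nab i0], which is zero. *)
Lemma nab_exact (phi : 'I_n -> V) : (2 <= n)%N ->
  (forall i j, nab i (phi j) = nab j (phi i)) ->
  exists g, forall i, nab i g = phi i.
Proof.
move=> n2 closed.
pose i0 : 'I_n := Ordinal (ltnW n2); pose i1 : 'I_n := Ordinal n2.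
have i01 : i0 != i1 by [].
have [g eg] := closed_exact i01 (closed i1 i0).
exists g => i; apply/eqP; rewrite -subr_eq0; apply/eqP/(nab_ker (i := i0)).
by rewrite nabD // nabN // nabC eg closed subrr.
Qed.

End Cohomology.

(** * Formal power series *)

Section MultiIndex.
Variable I : finType.
Local Notation idx := {ffun I -> nat}.
Implicit Types (s : idx) (c d : I) (l : seq I).

Definition sh c s : idx := [ffun d => (s d + (d == c))%N].

Definition cnt l : idx := [ffun c => count_mem c l].

Definition wrd s : seq I := flatten [seq nseq (s c) c | c <- index_enum I].

Lemma shC c d s : sh c (sh d s) = sh d (sh c s).
Proof. by apply/ffunP => e; rewrite !ffunE addnAC. Qed.

Lemma cnt_nil : cnt [::] = [ffun=> 0%N].
Proof. by apply/ffunP => e; rewrite !ffunE. Qed.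

Lemma cnt_cons c l : cnt (c :: l) = sh c (cnt l).
Proof. by apply/ffunP => e; rewrite !ffunE /= addnC eq_sym. Qed.

Lemma cnt_wrd s : cnt (wrd s) = s.
Proof.
apply/ffunP => c; rewrite ffunE /wrd count_flatten sumnE !big_map.
rewrite (bigD1 c) //= count_nseq /= eqxx mul1n big1 ?addn0 // => d /negPf dc.
by rewrite count_nseq /= dc.
Qed.

Lemma cnt_perm l l' : cnt l = cnt l' -> perm_eq l l'.
Proof.
move=> e; apply/allP => c _ /=; apply/eqP.
by have := congr1 (fun f : idx => f c) e; rewrite !ffunE.
Qed.

Variable R : comPzRingType.

(** The Leibniz rule along the word [l]. Words avoid binomial coefficients; the price is the
    invariance under permutation in [conv_perm]. *)
Fixpoint conv (u w : idx -> R) l : R :=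
  if l is c :: l' then conv (u \o sh c) w l' + conv u (w \o sh c) l'
  else u [ffun=> 0%N] * w [ffun=> 0%N].

Lemma conv_swap u w c d l : conv u w (c :: d :: l) = conv u w (d :: c :: l).
Proof.
have e (z : idx -> R) : (z \o sh c) \o sh d = (z \o sh d) \o sh c.
  by apply/funext => s /=; rewrite shC.
by rewrite /= !e; ring.
Qed.

Lemma conv_move u w c l1 l2 :
  conv u w (l1 ++ c :: l2) = conv u w (c :: l1 ++ l2).
Proof.
elim: l1 u w => // d l1 IH u w.
by rewrite -[RHS]conv_swap cat_cons [LHS]/= !IH.
Qed.

Lemma conv_perm u w l l' : perm_eq l l' -> conv u w l = conv u w l'.
Proof.
elim: l l' u w => [|c l IH] l' u w.
  by move/perm_size/esym/size0nil ->.
move=> ll'; have : c \in l' by rewrite -(perm_mem ll') inE eqxx.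
move: ll' => /[swap] /splitPr[l1 l2].
rewrite perm_sym perm_catC /= perm_cons perm_catC perm_sym => /IH ll'.
by rewrite conv_move /= !ll'.
Qed.

Definition dps := idx -> R.

HB.instance Definition _ := GRing.Zmodule.copy dps (idx -> R).

Implicit Types u w z : dps.

(* The value of [u : dps] at [s] stands for the [s]-th derivative of a formal power
   series at a point, so that the product is given by the Leibniz rule. *)
Definition dmul u w : dps := fun s => conv u w (wrd s).

Definition dshift c u : dps := u \o sh c.

Lemma dmul_cnt u w l : dmul u w (cnt l) = conv u w l.
Proof. by apply/conv_perm/cnt_perm; rewrite cnt_wrd. Qed.

Lemma dmul0 u w : dmul u w [ffun=> 0%N] = u [ffun=> 0%N] * w [ffun=> 0%N].
Proof. by rewrite -cnt_nil dmul_cnt cnt_nil. Qed.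

Lemma dmul_sh u w c s :
  dmul u w (sh c s) = dmul (dshift c u) w s + dmul u (dshift c w) s.
Proof. by rewrite -(cnt_wrd s) -cnt_cons !dmul_cnt. Qed.

Lemma idx_ind (P : idx -> Prop) :
  P [ffun=> 0%N] -> (forall c s, P s -> P (sh c s)) -> forall s, P s.
Proof.
move=> P0 PS s; rewrite -(cnt_wrd s); elim: (wrd s) => [|c l IH].
  by rewrite cnt_nil.
by rewrite cnt_cons; apply: PS.
Qed.

Lemma dmulC : commutative dmul.
Proof.
move=> u w; apply/funext => s; elim/idx_ind: s u w => [|c s IH] u w.
  by rewrite !dmul0 mulrC.
by rewrite !dmul_sh addrC ![dmul _ (dshift _ _) _]IH.
Qed.

Lemma dmulDl : left_distributive dmul +%R.
Proof.
move=> u w z; apply/funext => s; rewrite vaddE.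
elim/idx_ind: s u w z => [|c s IH] u w z; first by rewrite !dmul0 vaddE mulrDl.
by rewrite !dmul_sh -[dshift c (u + w)]/(dshift c u + dshift c w) !IH addrACA.
Qed.

Lemma dmulA : associative dmul.
Proof.
move=> u w z; apply/funext => s; elim/idx_ind: s u w z => [|c s IH] u w z.
  by rewrite !dmul0 mulrA.
have dM u' w' : dshift c (dmul u' w') = dmul (dshift c u') w' + dmul u' (dshift c w').
  by apply/funext => s'; rewrite vaddE -dmul_sh.
have dmulDr : right_distributive dmul +%R.
  by move=> a b b'; rewrite dmulC dmulDl ![dmul _ a]dmulC.
by rewrite !dmul_sh !dM dmulDl dmulDr !vaddE !IH addrA.
Qed.

Definition dps_one : dps := fun s => (s == [ffun=> 0%N])%:R.

Lemma dmul1 : left_id dps_one dmul.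
Proof.
have d0 w s : dmul 0 w s = 0.
  by apply: (addrI (dmul 0 w s)); rewrite addr0 -[X in X = _]vaddE -dmulDl addr0.
move=> w; apply/funext => s; elim/idx_ind: s w => [|c s IH] w.
  by rewrite dmul0 /dps_one eqxx mul1r.
rewrite dmul_sh IH; have -> : dshift c dps_one = 0.
  apply/funext => s'; rewrite /dshift /dps_one /=; case: eqP => // /ffunP/(_ c).
  by rewrite !ffunE eqxx addn1.
by rewrite d0 add0r.
Qed.

HB.instance Definition _ :=
  GRing.Zmodule_isComPzRing.Build dps dmulA dmulC dmul1 dmulDl.

Lemma dshift_der c : derivation (dshift c).
Proof. by split=> // u w; apply/funext => s; apply: dmul_sh. Qed.

Lemma dshiftC c d u : dshift c (dshift d u) = dshift d (dshift c u).
Proof. by apply/funext => s; rewrite /dshift /= shC. Qed.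

End MultiIndex.

(** * Formal solutions of the system *)

Section FormalSolution.
Variables (n m : nat) (R : comPzRingType).
Local Notation idx := {ffun indep n m -> nat}.
Local Notation dps := (dps (indep n m) R).
Local Notation D := (@dshift (indep n m) R).
Local Notation br := (br D).
Implicit Types (s t : idx) (u w : dps) (f g : 'I_m -> dps).

Let D_der c : derivation (D c). Proof. exact: dshift_der. Qed.
Let DC c d u : D c (D d u) = D d (D c u). Proof. exact: dshiftC. Qed.

Lemma dps_sumE (J : finType) (F : J -> dps) s :
  (\sum_i F i) s = \sum_i F i s.
Proof. by apply: (big_morph (fun u : dps => u s)). Qed.

Lemma dps_brE f g a s : br f g a s =
  \sum_b dmul (f b) (D (vvar b) (g a)) s -
  \sum_b dmul (g b) (D (vvar b) (f a)) s.
Proof. by rewrite brE /dir vaddE voppE !dps_sumE. Qed.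

Lemma conv_local (u u' w w' : dps) l :
  (forall s, (forall c, (s c <= cnt l c)%N) -> u s = u' s) ->
  (forall s, (forall c, (s c <= cnt l c)%N) -> w s = w' s) ->
  conv u w l = conv u' w' l.
Proof.
have le_sh s c l' : (forall d, (s d <= cnt l' d)%N) ->
    forall d, (sh c s d <= cnt (c :: l') d)%N.
  by move=> sl d; rewrite cnt_cons !ffunE leq_add2r; have := sl d; rewrite ffunE.
have le_cons s c l' : (forall d, (s d <= cnt l' d)%N) ->
    forall d, (s d <= cnt (c :: l') d)%N.
  move=> sl d; rewrite cnt_cons ffunE; apply: leq_trans (leq_addr _ _).
  exact: sl.
elim: l u u' w w' => [|c l IH] u u' w w' uu ww /=.
  by rewrite uu ?ww // => c; rewrite ffunE.
congr (_ + _); apply: IH => s sl /=.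
- exact/uu/le_sh.
- exact/ww/le_cons.
- exact/uu/le_cons.
- exact/ww/le_sh.
Qed.

(** * Formal solutions with prescribed parametric derivatives *)

Definition xdeg (P : pred 'I_n) s : nat := (\sum_(k | P k) s (xvar k))%N.

Lemma xdeg_shx P k s : xdeg P (sh (xvar k) s) = (xdeg P s + P k)%N.
Proof.
rewrite /xdeg; under eq_bigr do rewrite ffunE.
rewrite big_split /=; congr addn.
under eq_bigr => l _ do rewrite -[xvar l == xvar k]/(l == k).
rewrite big_mkcond (bigD1 k) //= eqxx big1 ?addn0 => [|l /negPf ->].
  by case: (P k).
by rewrite if_same.
Qed.

Lemma xdeg_shv P b s : xdeg P (sh (vvar b) s) = xdeg P s.
Proof. by apply: eq_bigr => k _; rewrite ffunE addn0. Qed.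

Lemma xdeg_le P s t : (forall c, (s c <= t c)%N) -> (xdeg P s <= xdeg P t)%N.
Proof. by move=> st; apply: leq_sum. Qed.

(** The bracket differentiates along the fibre only and its products involve sub-indices of [s], so
    it never raises the number of x-derivatives. This makes the recursion for solutions well
    founded. *)
Lemma br_local P N f f' g g' a s :
  (forall b t, (xdeg P t <= N)%N -> f b t = f' b t) ->
  (forall b t, (xdeg P t <= N)%N -> g b t = g' b t) ->
  (xdeg P s <= N)%N -> br f g a s = br f' g' a s.
Proof.
move=> ff gg sN; rewrite !dps_brE; congr (_ - _); apply: eq_bigr => b _;
  apply: conv_local => t; rewrite cnt_wrd => /(xdeg_le P) /leq_trans/(_ sN) tN.
- exact: ff.
- by apply: gg; rewrite xdeg_shv.
- exact: gg.
- by apply: ff; rewrite xdeg_shv.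
Qed.

Definition lower (c : indep n m) s : idx := [ffun d => (s d - (d == c))%N].

Lemma lowerK c s : (0 < s c)%N -> sh c (lower c s) = s.
Proof.
move=> sc; apply/ffunP => d; rewrite !ffunE.
by case: eqP => [->|_]; rewrite ?subn0 ?addn0 // subnK.
Qed.

(** Singles out the principal derivatives [(i, a, s)], with [k] the first x-variable occurring in
    [s]. *)
Definition lowest (i : 'I_n) s (k : 'I_n) : bool :=
  [&& k < i, 0 < s (xvar k) & [forall l : 'I_n, (l < k) ==> (s (xvar l) == 0)]]%N.

Lemma lowest_uniq i s k l : lowest i s k -> lowest i s l -> k = l.
Proof.
move=> /and3P[_ sk /forallP mk] /and3P[_ sl /forallP ml]; apply/val_inj => /=.
case: (ltngtP k l) => // kl.
- by have := implyP (ml k) kl; rewrite eqn0Ngt sk.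
- by have := implyP (mk l) kl; rewrite eqn0Ngt sl.
Qed.

(* The derivatives [(i, a, s)] such that no [x_k] with [k < i] occurs in [s]
   are prescribed; the others are found from the equation [curv k i = 0], where
   [x_k] is the first variable in [s]. *)
Fixpoint sol_rec N (V : 'I_n -> 'I_m -> dps) (i : 'I_n) (a : 'I_m) : dps :=
  fun s => if N is N'.+1 then
    if [pick k | lowest i s k] is Some k then
      V k a (sh (xvar i) (lower (xvar k) s)) -
      br (sol_rec N' V k) (sol_rec N' V i) a (lower (xvar k) s)
    else V i a s
  else V i a s.

Lemma xdeg_lower k s : (0 < s (xvar k))%N ->
  (xdeg predT (lower (xvar k) s)).+1 = xdeg predT s.
Proof. by move=> /lowerK {2}<-; rewrite xdeg_shx addn1. Qed.

(** Each unfolding removes one [x_k] and the bracket adds none, so fuel equal to the number of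
    x-derivatives suffices. *)
Lemma sol_rec_stable V N M i a s :
  (xdeg predT s <= N)%N -> (xdeg predT s <= M)%N ->
  sol_rec N V i a s = sol_rec M V i a s.
Proof.
have s0 i' s' k : (xdeg predT s' <= 0)%N -> lowest i' s' k = false.
  rewrite leqn0 sum_nat_eq0 => /forallP/(_ k) /eqP sk.
  by rewrite /lowest sk andbF.
elim: N M i a s => [|N IH] [|M] i a s sN sM //=.
- by case: pickP => // k; rewrite s0.
- by case: pickP => // k; rewrite s0.
case: pickP => // k /and3P[_ /xdeg_lower sk _]; congr (_ - _).
apply: (@br_local predT (minn N M)) => [b t|b t|].
- by rewrite leq_min => /andP[tN tM]; apply: IH.
- by rewrite leq_min => /andP[tN tM]; apply: IH.
- by move: sN sM; rewrite -sk !ltnS leq_min => -> ->.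
Qed.

Definition sol V i a : dps := fun s => sol_rec (xdeg predT s) V i a s.

Lemma sol_curv_lowest V (k i : 'I_n) a s : (k < i)%N ->
  (forall l : 'I_n, (l < k)%N -> s (xvar l) = 0%N) ->
  curv D (sol V) k i a s = 0.
Proof.
move=> ki sk.
have sh0 (j l : 'I_n) : (l < k)%N -> (k <= j)%N -> sh (xvar j) s (xvar l) = 0%N.
  move=> lk kj; rewrite ffunE (sk _ lk) -[xvar l == xvar j]/(l == j).
  by case: eqP => // lj; move: lk; rewrite ltnNge lj kj.
have shkk : sh (xvar k) s (xvar k) = (s (xvar k)).+1 by rewrite ffunE eqxx addn1.
have lk : lowest i (sh (xvar k) s) k.
  rewrite /lowest ki shkk /=; apply/forallP => l; apply/implyP => lk.
  by rewrite sh0.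
have loK : lower (xvar k) (sh (xvar k) s) = s.
  by apply/ffunP => c; rewrite !ffunE addnK.
rewrite /curv !(vaddE, voppE) /mapD /dshift /=.
have -> : sol V i a (sh (xvar k) s) =
    V k a (sh (xvar i) s) - br (sol V k) (sol V i) a s.
  rewrite /sol xdeg_shx addn1 /=; case: pickP => [l ll|/(_ k)]; last by rewrite lk.
  rewrite (lowest_uniq ll lk) loK; congr (_ - _).
  by apply: (@br_local predT (xdeg predT s)) => // b t ts; apply: sol_rec_stable.
(* This derivative is parametric, as no [x_l] with [l < k] occurs in it. *)
have -> : sol V k a (sh (xvar i) s) = V k a (sh (xvar i) s).
  rewrite /sol; case: (xdeg _ _) => //= N; case: pickP => // l /and3P[lk' + _].
  by rewrite sh0 // ltnW.
by ring.
Qed.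

(** The recursion imposes only those derivatives of [curv i j = 0] in which no [x_k] with [k < i]
    occurs. For such an [x_k], the Bianchi identity for [i, j, k] and the equations with smaller
    first index give [nab k (curv i j) = 0], which expresses the derivative by [x_k] through
    derivatives with one x-variable less. *)
Lemma sol_flat V i j : curv D (sol V) i j = 0.
Proof.
suff {i j} H N : forall i j : 'I_n, (i < N)%N -> (i < j)%N -> curv D (sol V) i j = 0.
  case: (ltngtP i j) => [ij|ji|/val_inj ->].
  - exact: H ij.
  - by rewrite curv_anti // (H j.+1 j i) // oppr0.
  - by rewrite curv_diag.
elim: N => // N IH i j; rewrite ltnS leq_eqVlt => /orP[/eqP iN|]; last exact: IH.
move=> ij; apply/funext => a; apply/funext => s.
have [M] := ubnP (xdeg (fun k => k < i)%N s).
elim: M a s => // M IHM a s; rewrite ltnS => sM.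
have [s0|] := boolP [forall k : 'I_n, (k < i)%N ==> (s (xvar k) == 0%N)].
  by apply: sol_curv_lowest => // l li; apply/eqP/(implyP (forallP s0 l)).
rewrite negb_forall => /existsP[k]; rewrite negb_imply -lt0n => /andP[ki sk].
have kj : (k < j)%N by exact: ltn_trans ij.
have := bianchi D_der DC (sol V) i j k.
rewrite (curv_anti _ _ j k) (IH k j) -?iN // (IH k i) -?iN // oppr0.
rewrite !nab_zero // !addr0 => /(congr1 (fun F => F a (lower (xvar k) s))).
rewrite /nab vaddE /mapD {1}/dshift vaddE /= lowerK // => e.
apply: etrans e; rewrite -[LHS]addr0; congr (_ + _).
have -> : (0 : R) = br (sol V k) 0 a (lower (xvar k) s).
  by rewrite br_anti br0l // oppr0.
have sl : (xdeg (fun k => k < i)%N (lower (xvar k) s) < M)%N.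
  apply: leq_trans sM.
  by rewrite -{2}(lowerK sk) xdeg_shx ki addn1.
apply: (@br_local (fun k => k < i)%N
  (xdeg (fun k => k < i)%N (lower (xvar k) s))) => // b t ts.
by rewrite IHM //; apply: leq_ltn_trans sl.
Qed.

Lemma sol_rec_id V N i a s : (forall i j : 'I_n, (i < j)%N -> curv D V i j = 0) ->
  sol_rec N V i a s = V i a s.
Proof.
move=> Vf; elim: N i a s => //= N IH i a s; case: pickP => // k /and3P[ki sk _].
have := congr1 (fun F => F a (lower (xvar k) s)) (Vf k i ki).
rewrite /curv !(vaddE, voppE) /mapD /dshift /= (lowerK sk) => e.
have -> : br (sol_rec N V k) (sol_rec N V i) a (lower (xvar k) s) =
   br (V k) (V i) a (lower (xvar k) s).
  apply: (@br_local predT (xdeg predT (lower (xvar k) s))) => // b t _; exact: IH.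
apply/esym/eqP; rewrite -subr_eq0; apply/eqP; apply: etrans e; ring.
Qed.

Lemma sol_id V i a s : (forall i j : 'I_n, (i < j)%N -> curv D V i j = 0) ->
  sol V i a s = V i a s.
Proof. exact: sol_rec_id. Qed.

(* The linearization of [curv] at [V]. *)
Definition dcurv (V X : 'I_n -> 'I_m -> dps) i j : 'I_m -> dps :=
  mapD (D (xvar i)) (X j) - mapD (D (xvar j)) (X i) +
  (br (X i) (V j) + br (V i) (X j)).

End FormalSolution.

Section FormalSolutionDerivative.
Variables (n m : nat) (R : realType).
Local Notation dps := (dps (indep n m) R).
Local Notation D := (@dshift (indep n m) R).

Lemma is_derive_conv (u w : R -> dps) (u' w' : dps) l :
  (forall s, is_derive (0 : R) 1 (fun r => u r s) (u' s)) ->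
  (forall s, is_derive (0 : R) 1 (fun r => w r s) (w' s)) ->
  is_derive (0 : R) 1 (fun r => conv (u r) (w r) l)
    (conv u' (w 0) l + conv (u 0) w' l).
Proof.
elim: l u u' w w' => [|c l IH] u u' w w' du dw /=.
  apply: is_derive_eq (is_deriveM (du [ffun=> 0%N]) (dw [ffun=> 0%N])) _.
  by rewrite /GRing.scale /= addrC mulrC.
have du' s : is_derive (0 : R) 1 (fun r => (u r \o sh c) s) ((u' \o sh c) s) := du _.
have dw' s : is_derive (0 : R) 1 (fun r => (w r \o sh c) s) ((w' \o sh c) s) := dw _.
apply: is_derive_eq (is_deriveD (IH _ _ _ _ du' dw) (IH _ _ _ _ du dw')) _.
by rewrite addrACA.
Qed.

Lemma is_derive_br (f g : R -> 'I_m -> dps) (f' g' : 'I_m -> dps) a s :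
  (forall b s, is_derive (0 : R) 1 (fun r => f r b s) (f' b s)) ->
  (forall b s, is_derive (0 : R) 1 (fun r => g r b s) (g' b s)) ->
  is_derive (0 : R) 1 (fun r => br D (f r) (g r) a s)
    ((br D f' (g 0) + br D (f 0) g') a s).
Proof.
move=> df dg.
have dsum (f1 g1 : R -> 'I_m -> dps) (f1' g1' : 'I_m -> dps) :
    (forall b s, is_derive (0 : R) 1 (fun r => f1 r b s) (f1' b s)) ->
    (forall b s, is_derive (0 : R) 1 (fun r => g1 r b s) (g1' b s)) ->
    is_derive (0 : R) 1
      (fun r => \sum_b dmul (f1 r b) (D (vvar b) (g1 r a)) s)
      (\sum_b (dmul (f1' b) (D (vvar b) (g1 0 a)) s +
               dmul (f1 0 b) (D (vvar b) (g1' a)) s)).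
  move=> df1 dg1.
  have -> : (fun r => \sum_b dmul (f1 r b) (D (vvar b) (g1 r a)) s) =
      \sum_b (fun r => dmul (f1 r b) (D (vvar b) (g1 r a)) s).
    by apply/funext => r; rewrite fct_sumE.
  apply: is_derive_sum => b.
  exact: (is_derive_conv (u := fun r => f1 r b) (w := fun r => D (vvar b) (g1 r a))).
have -> : (fun r => br D (f r) (g r) a s) =
    (fun r => \sum_b dmul (f r b) (D (vvar b) (g r a)) s) -
    (fun r => \sum_b dmul (g r b) (D (vvar b) (f r a)) s).
  by apply/funext => r; rewrite dps_brE.
apply: is_derive_eq (is_deriveB (dsum _ _ _ _ df dg) (dsum _ _ _ _ dg df)) _.
rewrite !vaddE !dps_brE !big_split /=; ring.
Qed.

(** Differentiating the recursion at [r = 0] gives the recursion for the linearized system, which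
    [X] satisfies. *)
Lemma is_derive_sol_rec (V X : 'I_n -> 'I_m -> dps) N i a s :
  (forall i j : 'I_n, (i < j)%N -> curv D V i j = 0) ->
  (forall i j : 'I_n, (i < j)%N -> dcurv V X i j = 0) ->
  is_derive (0 : R) 1
    (fun r => sol_rec N (fun i a s => V i a s + r * X i a s) i a s)
    (X i a s).
Proof.
move=> Vf Xf.
have dV i' a' s' : is_derive (0 : R) 1 (fun r => V i' a' s' + r * X i' a' s') (X i' a' s').
  apply: is_derive_eq (is_deriveD (is_derive_cst _ _ _)
    (is_deriveM (is_derive_id _ _) (is_derive_cst _ _ _))) _.
  by rewrite /GRing.scale /= add0r mulr0 add0r mulr1.
elim: N i a s => [|N IH] i a s /=; first exact: dV.
case: pickP => [k /and3P[ki sk _]|_]; last exact: dV.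
apply: is_derive_eq (is_deriveB (dV k a (sh (xvar i) (lower (xvar k) s)))
  (is_derive_br a (lower (xvar k) s) (IH k) (IH i))) _.
have := congr1 (fun F => F a (lower (xvar k) s)) (Xf k i ki).
rewrite /dcurv !(vaddE, voppE) /mapD /dshift /= (lowerK sk).
have -> : (fun i a s => V i a s + 0 * X i a s) = V.
  by apply/funext => j; apply/funext => b; apply/funext => t; rewrite mul0r addr0.
have e j : sol_rec N V j = V j.
  by apply/funext => b; apply/funext => t; exact: sol_rec_id.
rewrite !e => dc; apply/esym/eqP; rewrite -subr_eq0; apply/eqP.
by apply: etrans dc; ring.
Qed.

End FormalSolutionDerivative.

(** * Taylor series *)

Section Taylor.
Variables (A R : comPzRingType) (n m : nat) (D : indep n m -> A -> A).
Hypothesis D_der : forall c, derivation (D c).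
Hypothesis DC : forall c d a, D c (D d a) = D d (D c a).
Variable ev : A -> R.
Hypothesis evD : forall a b, ev (a + b) = ev a + ev b.
Hypothesis evM : forall a b, ev (a * b) = ev a * ev b.
Local Notation V := ('I_m -> A).
Local Notation dps := (dps (indep n m) R).

Lemma Dw_move c l1 l2 a : Dw D (l1 ++ c :: l2) a = Dw D (c :: l1 ++ l2) a.
Proof. by elim: l1 => //= d l1 ->; rewrite DC. Qed.

Lemma Dw_perm l l' a : perm_eq l l' -> Dw D l a = Dw D l' a.
Proof.
elim: l l' => [|c l IH] l'; first by move/perm_size/esym/size0nil ->.
move=> ll'; have : c \in l' by rewrite -(perm_mem ll') inE eqxx.
move: ll' => /[swap] /splitPr[l1 l2].
rewrite perm_sym perm_catC /= perm_cons perm_catC perm_sym => /IH ll'.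
by rewrite Dw_move /= ll'.
Qed.

(** With [ev] the evaluation at a point, this is a ring morphism to series that intertwines [D c]
    with the shift; it transports brackets and curvature between functions and series. *)
Definition taylor a : dps := fun s => ev (Dw D (wrd s) a).

Lemma taylor_cnt a l : taylor a (cnt l) = ev (Dw D l a).
Proof. by congr ev; apply/Dw_perm/cnt_perm; rewrite cnt_wrd. Qed.

Lemma taylor0 a : taylor a [ffun=> 0%N] = ev a.
Proof. by rewrite -cnt_nil taylor_cnt. Qed.

Lemma taylor_sh a c s : taylor a (sh c s) = taylor (D c a) s.
Proof.
rewrite -(cnt_wrd s) -cnt_cons !taylor_cnt; congr ev.
have -> : Dw D (wrd s) (D c a) = Dw D (rcons (wrd s) c) a by rewrite /Dw foldr_rcons.
by apply: Dw_perm; rewrite perm_sym perm_rcons.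
Qed.

Lemma taylor_D c a : taylor (D c a) = dshift c (taylor a).
Proof. by apply/funext => s; rewrite /dshift /= taylor_sh. Qed.

Lemma taylorD a b : taylor (a + b) = taylor a + taylor b.
Proof. by apply/funext => s; rewrite vaddE /taylor DwD. Qed.

Lemma taylor_zero : taylor 0 = 0.
Proof. by apply: (addrI (taylor 0)); rewrite -taylorD !addr0. Qed.

Lemma taylorN a : taylor (- a) = - taylor a.
Proof. by apply: (addrI (taylor a)); rewrite -taylorD !subrr taylor_zero. Qed.

Lemma taylorM a b : taylor (a * b) = taylor a * taylor b.
Proof.
apply/funext => s; change (taylor (a * b) s = dmul (taylor a) (taylor b) s).
elim/idx_ind: s a b => [|c s IH] a b; first by rewrite dmul0 !taylor0 evM.
by rewrite dmul_sh taylor_sh (derM (D_der c)) taylorD vaddE !IH -!taylor_D.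
Qed.

Lemma taylor_sum (I : Type) (r : seq I) (F : I -> A) :
  taylor (\sum_(i <- r) F i) = \sum_(i <- r) taylor (F i).
Proof. exact: (big_morph _ taylorD taylor_zero). Qed.

Definition vtaylor (f : V) : 'I_m -> dps := fun k => taylor (f k).

Lemma vtaylor_br f g : vtaylor (br D f g) = br (@dshift _ R) (vtaylor f) (vtaylor g).
Proof.
apply/funext => k; rewrite /vtaylor !brE /dir taylorD taylorN !taylor_sum.
by congr (_ - _); apply: eq_bigr => b _; rewrite taylorM taylor_D.
Qed.

Lemma vtaylorD f g : vtaylor (f + g) = vtaylor f + vtaylor g.
Proof. by apply/funext => k; rewrite /vtaylor !vaddE taylorD. Qed.

Lemma vtaylorN f : vtaylor (- f) = - vtaylor f.
Proof. by apply/funext => k; rewrite /vtaylor !voppE taylorN. Qed.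

Lemma vtaylor_map c f : vtaylor (mapD (D c) f) = mapD (@dshift _ R c) (vtaylor f).
Proof. by apply/funext => k; rewrite /vtaylor /mapD taylor_D. Qed.

Lemma vtaylor_curv (v : 'I_n -> V) i j :
  vtaylor (curv D v i j) = curv (@dshift _ R) (fun i => vtaylor (v i)) i j.
Proof. by rewrite /curv !vtaylorD vtaylorN !vtaylor_map vtaylor_br. Qed.

(** The linearized curvature of the tuple [nab i f] is the commutator of [nab i] and [nab j] applied
    to [f]. *)
Lemma vtaylor_dcurv (v : 'I_n -> V) (f : V) i j : (forall i j, curv D v i j = 0) ->
  dcurv (fun i => vtaylor (v i)) (fun i => vtaylor (nab D v i f)) i j = 0.
Proof.
move=> flat; rewrite /dcurv -!vtaylor_map -!vtaylor_br -vtaylorN -!vtaylorD.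
rewrite (br_anti _ _ (v j)).
have := nab_comm D_der DC v i j f; rewrite flat br0l // => e.
have -> : mapD (D (xvar i)) (nab D v j f) - mapD (D (xvar j)) (nab D v i f) +
   (- br D (v j) (nab D v i f) + br D (v i) (nab D v j f)) = 0.
  by rewrite -[RHS]e /nab; apply/funext => k; rewrite !(vaddE, voppE); ring.
by apply/funext => k; exact: taylor_zero.
Qed.

End Taylor.

(** * Smooth functions on the jet space *)

Section JetAnalysis.
Variables (R : realType) (n m : nat).
Local Notation J := (jet R n m).
Local Notation coord := (jcoord n m).
Implicit Types (t : J) (c d : coord) (F G : J -> R).

Lemma jet_cvg (Fi : set_system J) t : Filter Fi ->
  (forall c, (fun u : J => u c) @ Fi --> t c) -> Fi --> t.
Proof.
move=> FF cF; apply/cvg_sup => c A [B [[C oC <-] Ct] sBA].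
have /cF FC : nbhs (t c) C by exact: open_nbhs_nbhs.
by apply: (@filterS _ Fi FF _ A _ FC) => u Cu; exact: sBA.
Qed.

Definition box t (cs : seq coord) (e : R) : set J :=
  [set u | forall c, c \in cs -> `|u c - t c| < e].

(** The sets containing a box form a filter that converges to [t] in each coordinate, hence contains
    all neighbourhoods. *)
Lemma nbhs_box t (A : set J) : nbhs t A ->
  exists cs e, 0 < e /\ box t cs e `<=` A.
Proof.
pose Fi : set_system J := [set B | exists cs e, 0 < e /\ box t cs e `<=` B].
have FF : Filter Fi.
  split=> [|B C [cs [e [e0 sB]]] [ds [d [d0 sC]]]|B C sBC [cs [e [e0 sB]]]].
  - by exists [::], 1; split.
  - exists (cs ++ ds), (Num.min e d); split; first by rewrite lt_min e0.
    move=> u bu; split; [apply: sB|apply: sC] => c cc.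
      by have := bu c; rewrite mem_cat cc lt_min => /(_ isT) /andP[].
    by have := bu c; rewrite mem_cat cc orbT lt_min => /(_ isT) /andP[].
  - by exists cs, e; split=> //; apply: subset_trans sBC.
suff : Fi --> t by move/(_ A).
apply: jet_cvg => c B /= /nbhs_ballP[e /= e0 sB].
exists [:: c], e; split=> // u bu; apply: sB.
by rewrite /ball /= distrC; apply: bu; rewrite inE.
Qed.

Lemma coord_continuous c : continuous (fun u : J => u c).
Proof. exact: (@proj_continuous coord (fun=> R) c). Qed.

Lemma upd_same t c r : upd t c r c = r.
Proof. by rewrite /upd eqxx. Qed.

Lemma upd_neq t c d r : d != c -> upd t c r d = t d.
Proof. by rewrite /upd => /negPf ->. Qed.

Lemma upd_id t c : upd t c (t c) = t.
Proof. by apply/funext => d; rewrite /upd; case: eqP => [->|]. Qed.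

Lemma upd_upd t c r r' : upd (upd t c r) c r' = upd t c r'.
Proof. by apply/funext => d; rewrite /upd; case: eqP. Qed.

Lemma updC t c d r r' : c != d ->
  upd (upd t c r) d r' = upd (upd t d r') c r.
Proof.
move=> cd; apply/funext => e; rewrite /upd.
by case: (eqVneq e d) => [->|//]; rewrite eq_sym (negPf cd).
Qed.

Section Open.
Variable U : set 'rV[R]_n.
Hypothesis openU : open U.

Local Notation overU := (@Defs.over R n m U).

Lemma over_nbhs t : overU t -> nbhs t overU.
Proof.
move=> Ut; have /nbhs_ballP[e /= e0 sU] : nbhs (base t) U.
  exact: open_nbhs_nbhs.
have H (i : 'I_n) : nbhs t [set u : J | ball (t (inl (xvar i))) e (u (inl (xvar i)))].
  exact: (@coord_continuous (inl (xvar i)) t _ (nbhsx_ballx _ _ e0)).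
have H' : nbhs t [set u : J | forall i : 'I_n, ball (t (inl (xvar i))) e (u (inl (xvar i)))].
  exact: (@filter_forall J 'I_n _ (nbhs t) _ H).
apply: filterS H' => u Hu; apply: sU; split=> // i j.
by rewrite !mxE; apply: Hu.
Qed.

Lemma upd_cvg t c : (fun r : R => upd t c r : J) @ (t c) --> t.
Proof.
apply: (@jet_cvg _ _ (fmap_filter _ _)) => d A At.
change (nbhs (t c : R) [set r : R | A (upd t c r d)]).
have [dc|dc] := eqVneq d c; last first.
  apply: (@filterE R _ (nbhs_filter (t c : R))) => r /=; rewrite upd_neq //.
  exact: (nbhs_singleton At).
rewrite {}dc in At *; apply: filterS At => r Ar.
by rewrite /= upd_same.
Qed.

Lemma upd_near t c (A : set J) : nbhs t A -> \forall r \near t c, A (upd t c r).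
Proof. by move=> /(@upd_cvg t c). Qed.

(** * Regular functions over [U] *)

Definition eqU F G := forall t, overU t -> F t = G t.

Definition reg F := forall (l : seq coord) t, overU t ->
  {for t, continuous (iter_pder l F)} /\
  forall c, derivable (fun r : R => iter_pder l F (upd t c r)) (t c) 1.

Lemma upd_over_near t c : overU t -> \forall r \near t c, overU (upd t c r).
Proof. by move=> /over_nbhs; exact: upd_near. Qed.

Lemma pder_def F c t : derivable (fun r : R => F (upd t c r)) (t c) 1 ->
  is_derive (t c) 1 (fun r : R => F (upd t c r)) (pder c F t).
Proof. by move=> dF; apply: DeriveDef => //; rewrite /pder derive1E. Qed.

Lemma pder_val F c t a : is_derive (t c) 1 (fun r : R => F (upd t c r)) a ->
  pder c F t = a.
Proof. by move=> dF; rewrite /pder derive1E; exact: derive_val. Qed.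

Lemma eqU_near F G c t : eqU F G -> overU t ->
  \forall r \near t c, F (upd t c r) = G (upd t c r).
Proof. by move=> FG /(upd_over_near c); apply: filterS => r /FG. Qed.

Lemma eqU_derivable F G c t : eqU F G -> overU t ->
  derivable (fun r : R => F (upd t c r)) (t c) 1 ->
  derivable (fun r : R => G (upd t c r)) (t c) 1.
Proof.
by move=> FG Ut; apply: near_eq_derivable; exact: eqU_near.
Qed.

Lemma eqU_pder F G c : eqU F G -> eqU (pder c F) (pder c G).
Proof.
move=> FG t Ut; rewrite /pder !derive1E.
by apply: near_eq_derive; exact: eqU_near.
Qed.

Lemma eqU_continuous F G t : eqU F G -> overU t ->
  {for t, continuous F} -> {for t, continuous G}.
Proof.
move=> FG Ut cF A GA; have /cF FA : nbhs (F t) A by rewrite FG.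
have H : nbhs t (F @^-1` A `&` overU) := @filterI _ _ (nbhs_filter t) _ _ FA (over_nbhs Ut).
suff : nbhs t (G @^-1` A) by [].
apply: (@filterS _ _ (nbhs_filter t) _ _ _ H) => u [Au Uu] /=.
by rewrite -FG.
Qed.

(** A coinduction principle: to prove regularity it suffices to find a class closed under partial
    derivatives, without computing iterated ones. *)
Lemma reg_coind (C : (J -> R) -> Prop) :
  (forall F, C F -> forall t, overU t -> {for t, continuous F} /\
     forall c, derivable (fun r : R => F (upd t c r)) (t c) 1) ->
  (forall F c, C F -> exists2 G, C G & eqU (pder c F) G) ->
  forall F, C F -> reg F.
Proof.
move=> C1 CS F CF l; have [G CG FG] : exists2 G, C G & eqU (iter_pder l F) G.
  elim: l => [|c l [G CG FG]]; first by exists F.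
  have [G' CG' GG'] := CS G c CG; exists G' => // t Ut.
  by rewrite -GG' //; apply: eqU_pder FG _ _.
move=> t Ut; have GF : eqU G (iter_pder l F) by move=> u /FG.
have [cG dG] := C1 G CG t Ut; split; first exact: eqU_continuous cG.
by move=> c; apply: eqU_derivable (dG c).
Qed.

Lemma reg_continuous F t : reg F -> overU t -> {for t, continuous F}.
Proof. by move=> rF Ut; have [] := rF [::] t Ut. Qed.

Lemma reg_derivable F c t : reg F -> overU t ->
  derivable (fun r : R => F (upd t c r)) (t c) 1.
Proof. by move=> rF Ut; have [_ ] := rF [::] t Ut; apply. Qed.

Lemma reg_is_derive F c t : reg F -> overU t ->
  is_derive (t c) 1 (fun r : R => F (upd t c r)) (pder c F t).
Proof. by move=> rF Ut; apply/pder_def/reg_derivable. Qed.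

Lemma reg_pder F c : reg F -> reg (pder c F).
Proof.
move=> rF l t Ut; have -> : iter_pder l (pder c F) = iter_pder (rcons l c) F.
  by rewrite /iter_pder foldr_rcons.
exact: rF.
Qed.

Lemma reg_eqU F G : eqU F G -> reg F -> reg G.
Proof.
move=> FG rF; apply: (@reg_coind (fun G => exists2 F, reg F & eqU F G)).
- move=> {F G FG rF} G [F rF FG] t Ut; split.
    by apply: eqU_continuous FG _ _ => //; exact: reg_continuous.
  by move=> c; apply: eqU_derivable FG _ _ => //; exact: reg_derivable.
- move=> {F G FG rF} G c [F rF FG]; exists (pder c G) => //.
  by exists (pder c F); [exact: reg_pder | exact: eqU_pder].
- by exists F.
Qed.

Lemma pder_cst c a t : pder c (fun=> a) t = 0.
Proof. by apply: pder_val; exact: is_derive_cst. Qed.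

Lemma reg_cst a : reg (fun=> a).
Proof.
apply: (@reg_coind (fun F => exists a, F = fun=> a)); last by exists a.
  by move=> _ [b ->] t Ut; split=> [|c]; [exact: cst_continuous | exact: derivable_cst].
move=> _ c [b ->]; exists (fun=> 0); first by exists 0.
by move=> t _; rewrite pder_cst.
Qed.

Lemma is_derive_coord c d t : is_derive (t d) 1 (fun r : R => upd t d r c) (d == c)%:R.
Proof.
have [->|dc] := eqVneq d c.
  by under eq_fun do rewrite upd_same; exact: is_derive_id.
by under eq_fun do rewrite upd_neq 1?eq_sym //; exact: is_derive_cst.
Qed.

Lemma pder_coord c d t : pder d (fun u => u c) t = (d == c)%:R.
Proof. by apply: pder_val; exact: is_derive_coord. Qed.

Lemma reg_coord c : reg (fun u => u c).
Proof.
apply: (@reg_coind (fun F => F = (fun u => u c) \/ reg F)); last by left.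
- move=> F [->|rF] t Ut.
    split; first exact: coord_continuous.
    by move=> d; have [] := is_derive_coord c d t.
  split; first exact: reg_continuous.
  by move=> d; exact: reg_derivable.
- move=> F d [->|rF]; last by exists (pder d F) => //; right; exact: reg_pder.
  exists (fun=> (d == c)%:R); first by right; exact: reg_cst.
  by move=> t _; rewrite pder_coord.
Qed.

Definition dble F c t := derivable (fun r : R => F (upd t c r)) (t c) 1.

Lemma pderD_dble F G c t : dble F c t -> dble G c t ->
  pder c (fun u => F u + G u) t = pder c F t + pder c G t.
Proof.
by move=> dF dG; apply: pder_val; exact: is_deriveD (pder_def dF) (pder_def dG).
Qed.

Lemma pderM_dble F G c t : dble F c t -> dble G c t ->
  pder c (fun u => F u * G u) t = pder c F t * G t + F t * pder c G t.
Proof.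
move=> dF dG; apply: pder_val.
apply: is_derive_eq (is_deriveM (pder_def dF) (pder_def dG)) _.
by rewrite /GRing.scale /= upd_id; ring.
Qed.

Lemma pderD F G c t : reg F -> reg G -> overU t ->
  pder c (fun u => F u + G u) t = pder c F t + pder c G t.
Proof. by move=> rF rG Ut; apply: pderD_dble; exact: reg_derivable. Qed.

Lemma pderM F G c t : reg F -> reg G -> overU t ->
  pder c (fun u => F u * G u) t = pder c F t * G t + F t * pder c G t.
Proof. by move=> rF rG Ut; apply: pderM_dble; exact: reg_derivable. Qed.

(** Partial derivatives of a product are sums of products, so the coinduction runs over the whole
    algebra generated by regular functions. *)
Inductive reg_alg : (J -> R) -> Prop :=
| reg_alg_reg F : reg F -> reg_alg F
| reg_algD F G : reg_alg F -> reg_alg G -> reg_alg (fun u => F u + G u)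
| reg_algM F G : reg_alg F -> reg_alg G -> reg_alg (fun u => F u * G u).

Lemma reg_algP F : reg_alg F -> reg F.
Proof.
have C1 : forall F, reg_alg F -> forall t, overU t -> {for t, continuous F} /\
     forall c, derivable (fun r : R => F (upd t c r)) (t c) 1.
  move=> {}F aF t Ut; elim: aF => {F}[F rF|F G _ [cF dF] _ [cG dG]|F G _ [cF dF] _ [cG dG]].
  - by split; [exact: reg_continuous | move=> c; exact: reg_derivable].
  - by split; [exact: continuousD | move=> c; exact: derivableD].
  - by split; [exact: continuousM | move=> c; exact: derivableM].
apply: (reg_coind C1) => {}F c; elim=> {F}
  [F rF|F G aF [F' aF' FF'] aG [G' aG' GG']|F G aF [F' aF' FF'] aG [G' aG' GG']].
- by exists (pder c F) => //; apply/reg_alg_reg/reg_pder.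
- exists (fun u => F' u + G' u); first exact: reg_algD.
  move=> t Ut; rewrite -FF' // -GG' //.
  by apply: pderD_dble; [exact: (C1 _ aF _ Ut).2 | exact: (C1 _ aG _ Ut).2].
- exists (fun u => F' u * G u + F u * G' u).
    by apply: reg_algD; exact: reg_algM.
  move=> t Ut; rewrite -FF' // -GG' //.
  by apply: pderM_dble; [exact: (C1 _ aF _ Ut).2 | exact: (C1 _ aG _ Ut).2].
Qed.

Lemma regD F G : reg F -> reg G -> reg (fun u => F u + G u).
Proof. by move=> rF rG; apply/reg_algP/reg_algD; exact: reg_alg_reg. Qed.

Lemma regM F G : reg F -> reg G -> reg (fun u => F u * G u).
Proof. by move=> rF rG; apply/reg_algP/reg_algM; exact: reg_alg_reg. Qed.

Lemma reg_sum (I : Type) (r : seq I) (F : I -> J -> R) :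
  (forall i, reg (F i)) -> reg (fun u => \sum_(i <- r) F i u).
Proof.
move=> rF; elim: r => [|i r IH].
  by under eq_fun do rewrite big_nil; exact: reg_cst.
by under eq_fun do rewrite big_cons; exact: regD.
Qed.

Lemma pder_sum (I : Type) (r : seq I) (F : I -> J -> R) c t :
  (forall i, reg (F i)) -> overU t ->
  pder c (fun u => \sum_(i <- r) F i u) t = \sum_(i <- r) pder c (F i) t.
Proof.
move=> rF Ut; elim: r => [|i r IH].
  by under eq_fun do rewrite big_nil; rewrite big_nil pder_cst.
under eq_fun do rewrite big_cons; rewrite big_cons -IH pderD //.
exact: reg_sum.
Qed.

(** * Mean value estimates and symmetry of second derivatives *)

Definition btw (a b x : R) := a <= x <= b \/ b <= x <= a.

Lemma btw_dist a b x y e : btw a b x -> `|a - y| < e -> `|b - y| < e ->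
  `|x - y| < e.
Proof.
rewrite !ltr_distl => -[] /andP[? ?] /andP[? ?] /andP[? ?];
  by apply/andP; split; lra.
Qed.

Lemma mvt_upd F c t a b : reg F ->
  (forall x, btw a b x -> overU (upd t c x)) ->
  exists2 x, btw a b x &
    F (upd t c b) - F (upd t c a) = pder c F (upd t c x) * (b - a).
Proof.
move=> rF Ut; wlog ab : a b Ut / a <= b => [H|].
  have [|/ltW ba] := leP a b; first exact: H.
  have [|x xab e] := H b a _ ba.
    by move=> x [xab|xba]; apply: Ut; [right|left].
  exists x; first by case: xab; [right|left].
  by rewrite -opprB e -mulrN opprB.
have d x : a <= x <= b ->
    is_derive x 1 (fun r => F (upd t c r)) (pder c F (upd t c x)).
  move=> xab; have Ux : overU (upd t c x) by apply: Ut; left.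
  by have := reg_is_derive c rF Ux; rewrite upd_same; under eq_fun do rewrite upd_upd.
have [|||x xab e] := @MVT_segment R (fun r => F (upd t c r))
    (fun x => pder c F (upd t c x)) a b.
- exact: ab.
- by move=> x; rewrite in_itv /= => /andP[ax xb]; apply: d; rewrite !ltW.
- apply: derivable_within_continuous => x; rewrite in_itv /= => /d dx.
  by have [] := dx.
- by exists x => //; left; move: xab; rewrite in_itv.
Qed.

Lemma second_diff F c d t h : reg F -> c != d -> 0 < h ->
  (forall x y, t c <= x <= t c + h -> t d <= y <= t d + h ->
    overU (upd (upd t c x) d y)) ->
  exists x y, [/\ t c <= x <= t c + h, t d <= y <= t d + h &
    F (upd (upd t c (t c + h)) d (t d + h)) - F (upd (upd t c (t c + h)) d (t d))
    - (F (upd (upd t c (t c)) d (t d + h)) - F (upd (upd t c (t c)) d (t d)))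
    = pder d (pder c F) (upd (upd t c x) d y) * h * h].
Proof.
move=> rF cd h0 Ut.
pose g x := F (upd (upd t c x) d (t d + h)) - F (upd (upd t c x) d (t d)).
have dg y x : t d <= y <= t d + h -> t c <= x <= t c + h ->
    is_derive x 1 (fun r => F (upd (upd t c r) d y)) (pder c F (upd (upd t c x) d y)).
  move=> yI xI; have Ux := Ut x y xI yI.
  have := reg_is_derive c rF Ux; rewrite upd_neq // upd_same.
  by under eq_fun do rewrite -updC // upd_upd.
have dd : t d <= t d <= t d + h by rewrite lexx lerDl ltW.
have dh : t d <= t d + h <= t d + h by rewrite lexx lerDl ltW.
have dgx x (xI : t c <= x <= t c + h) := is_deriveB (dg _ _ dh xI) (dg _ _ dd xI).
have [|||x] := @MVT_segment R g
  (fun x => pder c F (upd (upd t c x) d (t d + h)) - pder c F (upd (upd t c x) d (t d)))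
  (t c) (t c + h).
- by rewrite lerDl ltW.
- by move=> x; rewrite in_itv /= => /andP[ax xb]; apply: dgx; rewrite !ltW.
- apply: derivable_within_continuous => x; rewrite in_itv /= => /dgx dx.
  by have [] := dx.
have addhK z : z + h - z = h by ring.
rewrite in_itv /= addhK => xI e.
have [|y yI e'] := @mvt_upd (pder c F) d (upd t c x) (t d) (t d + h) (reg_pder c rF).
  move=> y [yI|/andP[y1 y2]]; apply: Ut => //.
  by apply/andP; split; lra.
exists x, y; split=> //.
  by case: yI => // /andP[y1 y2]; apply/andP; split; lra.
by move: e; rewrite /g e' addhK => ->.
Qed.

Lemma nbhs_pder_box F t e : reg F -> overU t -> 0 < e ->
  exists cs k, 0 < k /\ forall u, box t cs k u -> overU u /\ `|F u - F t| < e.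
Proof.
move=> rF Ut e0.
have : nbhs t (overU `&` [set u | `|F u - F t| < e]).
  apply: (@filterI _ _ (nbhs_filter t)); first exact: over_nbhs.
  have := reg_continuous rF Ut => /(_ _ (nbhsx_ballx _ _ e0)).
  by apply: (@filterS _ _ (nbhs_filter t)) => u; rewrite /ball /= distrC.
by move=> /nbhs_box[cs [k [k0 sb]]]; exists cs, k; split=> // u /sb.
Qed.

Lemma dist_half (a b z e : R) :
  `|z - a| < e / 2 -> `|z - b| < e / 2 -> `|a - b| <= e.
Proof. by rewrite !ltr_distl ler_distl => /andP[? ?] /andP[? ?]; apply/andP; split; lra. Qed.

(** The same second difference is evaluated in both orders by [second_diff], at intermediate points
    arbitrarily close to [t]. *)
Lemma schwarz F c d t : reg F -> overU t ->
  pder c (pder d F) t = pder d (pder c F) t.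
Proof.
move=> rF Ut; have [->//|cd] := eqVneq c d.
apply/eqP; rewrite -subr_eq0 -normr_le0; apply/ler_addgt0Pl => e e0.
rewrite addr0; have e2 : 0 < e / 2 by lra.
have [cs [r [r0 b1]]] := nbhs_pder_box (reg_pder c (reg_pder d rF)) Ut e2.
have [ds [s [s0 b2]]] := nbhs_pder_box (reg_pder d (reg_pder c rF)) Ut e2.
have [h [h0 hr hs]] : exists h, [/\ 0 < h, h < r & h < s].
  have m0 : 0 < Num.min r s by rewrite lt_min r0.
  have mr : Num.min r s <= r by rewrite ge_min lexx.
  have ms : Num.min r s <= s by rewrite ge_min lexx orbT.
  by exists (Num.min r s / 2); split; lra.
have bx k ls x y : h < k -> t c <= x <= t c + h -> t d <= y <= t d + h ->
    box t ls k (upd (upd t c x) d y).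
  move=> hk xI yI e' _; rewrite /upd; case: eqP => [->|_].
    by rewrite ltr_distl; move/andP: yI => [? ?]; apply/andP; split; lra.
  case: eqP => [->|_]; last by rewrite subrr normr0; lra.
  by rewrite ltr_distl; move/andP: xI => [? ?]; apply/andP; split; lra.
have [|x [y [xI yI e1]]] := second_diff (t := t) rF cd h0.
  by move=> x y xI yI; have [] := b1 _ (bx r cs x y hr xI yI).
have dc : d != c by rewrite eq_sym.
have [|y' [x' [yI' xI' e2']]] := second_diff (t := t) rF dc h0.
  by move=> y' x' yI' xI'; rewrite -updC //; have [] := b1 _ (bx r cs x' y' hr xI' yI').
have [_ B1] := b1 _ (bx r cs x' y' hr xI' yI').
have [_ B2] := b2 _ (bx s ds x y hs xI yI).
have E : pder d (pder c F) (upd (upd t c x) d y) =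
    pder c (pder d F) (upd (upd t c x') d y').
  have hh : h * h != 0 by rewrite mulf_neq0 // gt_eqF.
  have U2 a b : upd (upd t d b) c a = upd (upd t c a) d b by exact: updC.
  rewrite !U2 in e2'.
  have aux (a b k l : R) : a - b - (k - l) = a - k - (b - l) by ring.
  have e3 := etrans (esym e1) (etrans (aux _ _ _ _) e2').
  by apply: (mulIf hh); rewrite /= [LHS]mulrA [RHS]mulrA; exact: e3.
rewrite E in B2; exact: dist_half B1 B2.
Qed.

(** Strict differentiability in finitely many coordinates: they are changed one at a time, with the
    mean value theorem and the continuity of the partial derivatives. It replaces the chain rule
    along curves. *)
Lemma strict_diff F t cs : reg F -> overU t -> uniq cs -> forall e, 0 < e ->
  exists ks k, 0 < k /\ forall u w, box t ks k u -> box t ks k w ->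
    (forall c, c \notin cs -> u c = w c) ->
    `|F u - F w - \sum_(c <- cs) pder c F t * (u c - w c)| <=
    e * \sum_(c <- cs) `|u c - w c|.
Proof.
move=> rF Ut + e e0; elim: cs => [|c cs IH] /=.
  move=> _; exists [::], 1; split=> // u w _ _ uw.
  have -> : u = w by apply/funext => d; exact: uw.
  by rewrite !big_nil !subrr normr0 mulr0.
move=> /andP[ccs /IH[ks [k [k0 H]]]].
have [ls [l [l0 Hl]]] := nbhs_pder_box (reg_pder c rF) Ut e0.
exists (ks ++ ls), (Num.min k l); split; first by rewrite lt_min k0.
move=> u w bu bw uw.
have split_box z : box t (ks ++ ls) (Num.min k l) z -> box t ks k z /\ box t ls l z.
  move=> bz; split=> d dd; have := bz d;
    by rewrite mem_cat dd ?orbT lt_min => /(_ isT) /andP[].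
have [bu1 bu2] := split_box _ bu; have [bw1 bw2] := split_box _ bw.
pose z := upd w c (u c).
have bz1 : box t ks k z.
  by move=> d dd; rewrite /z /upd; case: eqP => [<-|_]; [exact: bu1|exact: bw1].
have uz d : d \notin cs -> u d = z d.
  rewrite /z /upd; case: eqP => [->//|/eqP dc] dcs.
  by apply: uw; rewrite inE negb_or dc.
have Huz := H u z bu1 bz1 uz.
have bwx x : btw (w c) (u c) x -> box t ls l (upd w c x).
  move=> xI d dd; rewrite /upd; case: eqP => [dc|_]; last exact: bw2.
  by rewrite -dc in xI *; apply: (btw_dist xI); [exact: bw2|exact: bu2].
have [|x xI] := @mvt_upd F c w (w c) (u c) rF.
  by move=> x /bwx /Hl[].
rewrite upd_id -/z => ezw; have [_ Hx] := Hl _ (bwx _ xI).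
have sum1 : \sum_(d <- cs) pder d F t * (u d - z d) =
            \sum_(d <- cs) pder d F t * (u d - w d).
  apply: eq_big_seq => d dcs; rewrite /z upd_neq //.
  by apply: contraNneq ccs => <-.
have sum2 : \sum_(d <- cs) `|u d - z d| = \sum_(d <- cs) `|u d - w d|.
  apply: eq_big_seq => d dcs; rewrite /z upd_neq //.
  by apply: contraNneq ccs => <-.
rewrite sum1 sum2 in Huz; rewrite !big_cons.
set S1 := \sum_(_ <- _) _ in Huz *; set S2 := \sum_(_ <- _) _ in Huz *.
have -> : F u - F w - (pder c F t * (u c - w c) + S1) =
  (F u - F z - S1) + (pder c F (upd w c x) - pder c F t) * (u c - w c).
  by rewrite mulrBl -ezw; ring.
apply: le_trans (ler_normD _ _) _; rewrite [e * (_ + _)]mulrDr [leLHS]addrC; apply: lerD => //.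
by rewrite normrM ler_wpM2r // ltW.
Qed.

(** * Functions of finite order and truncated vector fields *)

Definition ordk k F := forall t t', overU t -> overU t' ->
  (forall c, (jorder c <= k)%N -> t c = t' c) -> F t = F t'.

Lemma ordk_le k l F : (k <= l)%N -> ordk k F -> ordk l F.
Proof. by move=> kl oF t t' Ut Ut' tt'; apply: oF => // c /leq_trans/(_ kl); exact: tt'. Qed.

Lemma base_eq k t t' : (forall c, (jorder c <= k)%N -> t c = t' c) -> base t = base t'.
Proof. by move=> tt'; apply/rowP => i; rewrite !mxE tt'. Qed.

Lemma over_upd t q r : overU t -> overU (upd t (inr q) r).
Proof.
rewrite /Defs.over /=; have -> // : base (upd t (inr q) r) = base t.
by apply/rowP => i; rewrite !mxE upd_neq.
Qed.

Lemma pder_high k F c t : ordk k F -> overU t -> (k < jorder c)%N ->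
  pder c F t = 0.
Proof.
move=> oF Ut; case: c => [//|q] kq.
rewrite -(pder_cst (inr q) (F t) t) /pder; congr (derive1 _ _).
apply/funext => r; apply: oF; [exact: over_upd | exact: Ut | move=> c ck].
by rewrite upd_neq //; apply: contraTneq ck => ->; rewrite -ltnNge.
Qed.

Lemma ordk_pder k F c : ordk k F -> ordk k (pder c F).
Proof.
move=> oF t t' Ut Ut' tt'; have [ck|ck] := leqP (jorder c) k; last first.
  by rewrite !(pder_high oF).
rewrite /pder !derive1E tt' //; apply: near_eq_derive.
have := upd_over_near c Ut; rewrite tt' //; apply: filterS => r Ur.
have tt'r d : (jorder d <= k)%N -> upd t c r d = upd t' c r d.
  by move=> dk; rewrite /upd; case: eqP => // _; exact: tt'.
by apply: oF => //; move: Ur; rewrite /Defs.over /= (base_eq tt'r).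
Qed.

Definition sm F := (exists k, ordk k F) /\ reg F.

Lemma sm_eqU F G : eqU F G -> sm F -> sm G.
Proof.
move=> FG [[k oF] rF]; split; last exact: reg_eqU rF.
by exists k => t t' Ut Ut' tt'; rewrite -!FG //; exact: oF.
Qed.

Lemma sm_cst a : sm (fun=> a).
Proof. by split; [exists 0%N | exact: reg_cst]. Qed.

Lemma sm_coord c : sm (fun u => u c).
Proof. by split; [exists (jorder c) => t t' _ _; apply | exact: reg_coord]. Qed.

Lemma smD F G : sm F -> sm G -> sm (fun u => F u + G u).
Proof.
move=> [[k oF] rF] [[l oG] rG]; split; last exact: regD.
exists (maxn k l) => t t' Ut Ut' tt'.
by rewrite (ordk_le (leq_maxl k l) oF Ut Ut') // (ordk_le (leq_maxr k l) oG Ut Ut').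
Qed.

Lemma smM F G : sm F -> sm G -> sm (fun u => F u * G u).
Proof.
move=> [[k oF] rF] [[l oG] rG]; split; last exact: regM.
exists (maxn k l) => t t' Ut Ut' tt'.
by rewrite (ordk_le (leq_maxl k l) oF Ut Ut') // (ordk_le (leq_maxr k l) oG Ut Ut').
Qed.

Lemma sm_sum (I : Type) (r : seq I) (F : I -> J -> R) :
  (forall i, sm (F i)) -> sm (fun u => \sum_(i <- r) F i u).
Proof.
move=> rF; elim: r => [|i r IH].
  by apply: sm_eqU (sm_cst 0) => t _; rewrite big_nil.
by apply: sm_eqU (smD (rF i) IH) => t _; rewrite big_cons.
Qed.

Lemma sm_pder F c : sm F -> sm (pder c F).
Proof.
by move=> [[k oF] rF]; split; [exists k; exact: ordk_pder | exact: reg_pder].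
Qed.

(** Exponents are bounded by [k] one by one, so the list contains all derivatives of order at most
    [k] and some of higher order, which contribute zero to the sums. *)
Definition qlist k : seq (depvar n m) := undup
  (map (fun p : 'I_n * 'I_m * {ffun indep n m -> 'I_k.+1} =>
          (p.1, [ffun d => nat_of_ord (p.2 d)]) : depvar n m)
       (index_enum _)).

Definition clist k : seq coord :=
  map inl (index_enum (indep n m)) ++ map inr (qlist k).

Lemma mem_qlist k (q : depvar n m) : (\sum_d q.2 d <= k)%N -> q \in qlist k.
Proof.
move=> qk; rewrite mem_undup; apply/mapP.
have qd (d : indep n m) : (q.2 d < k.+1)%N.
  by rewrite ltnS; apply: leq_trans qk; rewrite (bigD1 d) //= leq_addr.
exists (q.1, [ffun d => Ordinal (qd d)]); first exact: mem_index_enum.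
case: q qk qd => p s /= _ sd; congr (_, _).
by apply/ffunP => d; rewrite !ffunE.
Qed.

Lemma uniq_clist k : uniq (clist k).
Proof.
rewrite cat_uniq !map_inj_uniq ?undup_uniq ?index_enum_uniq ?andbT //=.
- by apply/hasPn => _ /mapP[q _ ->]; apply/mapP => -[].
- by move=> x y [].
- by move=> x y [].
Qed.

Lemma mem_clist k c : (jorder c <= k)%N -> c \in clist k.
Proof.
case: c => [d _|q /mem_qlist qk]; rewrite mem_cat; apply/orP.
  by left; apply/map_f; exact: mem_index_enum.
by right; exact: map_f.
Qed.

Lemma fs_clist k K (g : coord -> R) : (k <= K)%N ->
  (forall c, (k < jorder c)%N -> g c = 0) ->
  \sum_(c \in [set: coord]) g c = \sum_(c <- clist K) g c.
Proof.
move=> kK g0; rewrite (fsbigE (clist K)) ?uniq_clist //.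
  by apply: eq_bigl => c; rewrite in_setT.
move=> c _ cK; apply: g0; rewrite ltnNge; apply: contra cK => /leq_trans ck.
exact/mem_clist/ck.
Qed.

Lemma fs_qlist k K (g : depvar n m -> R) : (k <= K)%N ->
  (forall q : depvar n m, (k < \sum_d q.2 d)%N -> g q = 0) ->
  \sum_(q \in [set: depvar n m]) g q = \sum_(q <- qlist K) g q.
Proof.
move=> kK g0; rewrite (fsbigE (qlist K)) ?undup_uniq //.
  by apply: eq_bigl => c; rewrite in_setT.
move=> q _ qK; apply: g0; rewrite ltnNge; apply: contra qK => /leq_trans qk.
exact/mem_qlist/qk.
Qed.

(* The vector field with components [X], truncated to finitely many coordinates:
   harmless as soon as [K] is at least the order of [F]. *)
Definition vf K (X : coord -> J -> R) F : J -> R :=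
  fun t => \sum_(c <- clist K) X c t * pder c F t.

Definition shift (c : indep n m) (e : coord) : J -> R :=
  match e with
  | inl d => fun=> (d == c)%:R
  | inr q => fun u => u (inr (raise c q))
  end.

Lemma sm_shift (c : indep n m) e : sm (shift c e).
Proof. by case: e => [d|q] /=; [exact: sm_cst | exact: sm_coord]. Qed.

Lemma tder_vf k K (c : indep n m) F t : ordk k F -> (k <= K)%N -> overU t ->
  tder c F t = vf K (shift c) F t.
Proof.
move=> oF kK Ut; rewrite /tder /vf /clist big_cat !big_map /=; congr (_ + _).
  rewrite (bigD1 c) //= eqxx mul1r big1 ?addr0 // => d /negPf ->.
  by rewrite mul0r.
apply: (fs_qlist kK) => q qk.
by rewrite (pder_high oF) ?mulr0.
Qed.

Lemma sm_vf K X F : (forall c, sm (X c)) -> sm F -> sm (vf K X F).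
Proof. by move=> sX sF; apply: sm_sum => c; exact: (smM (sX c) (sm_pder c sF)). Qed.

Lemma eqU_vf K X F G : eqU F G -> eqU (vf K X F) (vf K X G).
Proof.
by move=> FG t Ut; apply: eq_bigr => c _; congr (_ * _); exact: eqU_pder FG t Ut.
Qed.

Lemma eqU_tder (c : indep n m) F G : sm F -> eqU F G -> eqU (tder c F) (tder c G).
Proof.
move=> sF FG t Ut; have [[k oF] _] := sF; have [[l oG] _] := sm_eqU FG sF.
rewrite (tder_vf c oF (leq_maxl k l)) // (tder_vf c oG (leq_maxr k l)) //.
exact: eqU_vf.
Qed.

Lemma vfD K X F G t : reg F -> reg G -> overU t ->
  vf K X (fun u => F u + G u) t = vf K X F t + vf K X G t.
Proof.
move=> rF rG Ut; rewrite -big_split; apply: eq_bigr => c _ /=.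
by rewrite pderD // mulrDr.
Qed.

Lemma vfM K X F G t : reg F -> reg G -> overU t ->
  vf K X (fun u => F u * G u) t = vf K X F t * G t + F t * vf K X G t.
Proof.
move=> rF rG Ut; rewrite mulr_suml mulr_sumr -big_split; apply: eq_bigr => c _ /=.
by rewrite pderM // mulrDr mulrA mulrCA.
Qed.

Lemma vf_comm K X Y F t : (forall c, reg (X c)) -> (forall c, reg (Y c)) ->
  reg F -> overU t ->
  vf K X (vf K Y F) t - vf K Y (vf K X F) t =
  \sum_(c <- clist K) (vf K X (Y c) t - vf K Y (X c) t) * pder c F t.
Proof.
move=> rX rY rF Ut.
have e (X' Y' : coord -> J -> R) : (forall c, reg (Y' c)) -> vf K X' (vf K Y' F) t =
    \sum_(c <- clist K) vf K X' (Y' c) t * pder c F t +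
    \sum_(c <- clist K) \sum_(d <- clist K) X' c t * Y' d t * pder c (pder d F) t.
  move=> rY'; rewrite {1}/vf.
  under eq_bigr => c _.
    rewrite pder_sum; last exact: Ut; last first.
      by move=> d; exact: (regM (rY' d) (reg_pder d rF)).
    under eq_bigr => d _ do rewrite (pderM c (rY' d) (reg_pder d rF) Ut).
    rewrite big_split mulrDr !mulr_sumr.
    over.
  rewrite big_split /=; congr (_ + _).
    rewrite exchange_big /=; apply: eq_bigr => c _; rewrite /vf mulr_suml.
    by apply: eq_bigr => d _; rewrite mulrA.
  by apply: eq_bigr => c _; apply: eq_bigr => d _; rewrite mulrA.
have swap : \sum_(c <- clist K) \sum_(d <- clist K) Y c t * X d t * pder c (pder d F) t =
    \sum_(c <- clist K) \sum_(d <- clist K) X c t * Y d t * pder c (pder d F) t.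
  rewrite exchange_big; apply: eq_bigr => c _; apply: eq_bigr => d _ /=.
  exact: (congr2 *%R (mulrC _ _) (schwarz d c rF Ut)).
apply: (etrans (congr2 (fun a b => a - b) (e X Y rY)
                  (etrans (e Y X rX) (congr1 (fun z => _ + z) swap)))).
rewrite opprD addrACA subrr addr0 -sumrB; apply: eq_bigr => c _.
by rewrite mulrBl.
Qed.

Local Notation dps := (dps (indep n m) R).
Local Notation D := (@dshift (indep n m) R).

Lemma sm_tder_vf F : sm F -> exists k, forall K t (c : indep n m), (k <= K)%N ->
  overU t -> tder c F t = vf K (shift c) F t.
Proof. by move=> [[k oF] rF]; exists k => K t c kK Ut; exact: tder_vf oF kK Ut. Qed.

Lemma tderD (c : indep n m) F G t : sm F -> sm G -> overU t ->
  tder c (fun u => F u + G u) t = tder c F t + tder c G t.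
Proof.
move=> sF sG Ut; have [k kF] := sm_tder_vf sF; have [l lG] := sm_tder_vf sG.
have [p pFG] := sm_tder_vf (smD sF sG); pose K := maxn k (maxn l p).
rewrite (kF K) ?(lG K) ?(pFG K) ?leq_max ?leqnn ?orbT //.
exact: (vfD K (shift c) sF.2 sG.2 Ut).
Qed.

Lemma tderM (c : indep n m) F G t : sm F -> sm G -> overU t ->
  tder c (fun u => F u * G u) t = tder c F t * G t + F t * tder c G t.
Proof.
move=> sF sG Ut; have [k kF] := sm_tder_vf sF; have [l lG] := sm_tder_vf sG.
have [p pFG] := sm_tder_vf (smM sF sG); pose K := maxn k (maxn l p).
rewrite (kF K) ?(lG K) ?(pFG K) ?leq_max ?leqnn ?orbT //.
exact: (vfM K (shift c) sF.2 sG.2 Ut).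
Qed.

Lemma vf_coord K (X : coord -> J -> R) e t : (jorder e <= K)%N ->
  vf K X (fun u => u e) t = X e t.
Proof.
move=> eK; rewrite /vf (bigD1_seq e) ?mem_clist ?uniq_clist //= pder_coord eqxx mulr1.
by rewrite big1 ?addr0 // => c /negPf ce; rewrite pder_coord ce mulr0.
Qed.

Lemma vf_cst K (X : coord -> J -> R) a t : vf K X (fun=> a) t = 0.
Proof. by rewrite /vf big1 // => c _; rewrite pder_cst mulr0. Qed.

Lemma tder_coord (c : indep n m) e t : overU t ->
  tder c (fun u => u e) t = shift c e t.
Proof.
move=> Ut; have [k kF] := sm_tder_vf (sm_coord e).
rewrite (kF (maxn k (jorder e))) ?leq_maxl //.
by apply: vf_coord; rewrite leq_maxr.
Qed.

Lemma tder_cst (c : indep n m) a t : overU t -> tder c (fun=> a) t = 0.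
Proof.
by move=> Ut; have [k kF] := sm_tder_vf (sm_cst a); rewrite (kF k) // vf_cst.
Qed.

(** * Jets as formal power series *)

Definition jetser t (i : 'I_n) (a : 'I_m) : dps := fun s => t (inr (i, a, s)).

(** The coefficients of [u] are the total derivatives of its constant term. The class is stable
    under the operations in [curv], so that differential consequences become coefficients of a
    series. *)
Definition series_like (u : J -> dps) := forall s, sm (fun t => u t s) /\
  forall (c : indep n m) t, overU t -> tder c (fun t => u t s) t = u t (sh c s).

Lemma series_like_jetser i a : series_like (fun t => jetser t i a).
Proof. by move=> s; split=> [|c t Ut]; [exact: sm_coord | exact: tder_coord]. Qed.

Lemma series_like_shift (c : indep n m) u : series_like u ->
  series_like (fun t => D c (u t)).
Proof.
move=> su s; split=> [|d t Ut]; have [su1 su2] := su (sh c s);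
  by rewrite ?su2 /dshift //= shC.
Qed.

Lemma series_likeD u w : series_like u -> series_like w ->
  series_like (fun t => u t + w t).
Proof.
move=> su sw s; have [su1 su2] := su s; have [sw1 sw2] := sw s.
split=> [|c t Ut]; first exact: smD.
by rewrite (tderD c su1 sw1 Ut) su2 // sw2.
Qed.

Lemma series_likeN u : series_like u -> series_like (fun t => - u t).
Proof.
move=> su s; have [su1 su2] := su s.
have e : eqU (fun t => -1 * u t s) (fun t => (- u t) s) by move=> t _; rewrite voppE mulN1r.
split=> [|c t Ut]; first exact: sm_eqU e (smM (sm_cst _) su1).
rewrite -(eqU_tder c (smM (sm_cst _) su1) e Ut) (tderM c (sm_cst _) su1 Ut).
by rewrite tder_cst // mul0r add0r su2 // mulN1r.
Qed.

Lemma series_likeM u w : series_like u -> series_like w ->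
  series_like (fun t => dmul (u t) (w t)).
Proof.
suff H l u' w' : series_like u' -> series_like w' ->
    sm (fun t => conv (u' t) (w' t) l) /\
    forall (c : indep n m) t, overU t ->
      tder c (fun t => conv (u' t) (w' t) l) t = conv (u' t) (w' t) (c :: l).
  move=> su sw s; have [H1 H2] := H (wrd s) u w su sw; split=> // c t Ut.
  by rewrite (H2 c t Ut) -dmul_cnt cnt_cons cnt_wrd.
elim: l u' w' => [|d l IH] u' w' su sw.
  have [su1 su2] := su [ffun=> 0%N]; have [sw1 sw2] := sw [ffun=> 0%N].
  split=> [|c t Ut] /=; first exact: smM.
  by rewrite (tderM c su1 sw1 Ut) su2 // sw2.
have [IH1 IH2] := IH _ _ (series_like_shift d su) sw.
have [IH3 IH4] := IH _ _ su (series_like_shift d sw).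
split=> [|c t Ut]; first exact: smD.
rewrite -conv_swap /= (tderD c IH1 IH3 Ut) IH2 // IH4 //=.
Qed.

Lemma series_like_sum (I : Type) (r : seq I) (u : I -> J -> dps) :
  (forall i, series_like (u i)) -> series_like (fun t => \sum_(i <- r) u i t).
Proof.
move=> su; elim: r => [|i r IH].
  have -> : (fun t => \sum_(i <- [::]) u i t) = (fun=> 0).
    by apply/funext => t; rewrite big_nil.
  by move=> s; split=> [|c t Ut]; [exact: (sm_cst 0) | exact: tder_cst].
have -> : (fun t => \sum_(i <- i :: r) u i t) = (fun t => u i t + \sum_(i <- r) u i t).
  by apply/funext => t; rewrite big_cons.
exact: series_likeD.
Qed.

Lemma series_like_br (f g : J -> 'I_m -> dps) a :
  (forall b, series_like (fun t => f t b)) -> (forall b, series_like (fun t => g t b)) ->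
  series_like (fun t => br D (f t) (g t) a).
Proof.
move=> sf sg; under eq_fun do rewrite brE /dir.
apply: series_likeD.
  by apply: series_like_sum => b; apply/series_likeM/series_like_shift.
by apply/series_likeN/series_like_sum => b; apply/series_likeM/series_like_shift.
Qed.

Lemma series_like_curv i j a : series_like (fun t => curv D (jetser t) i j a).
Proof.
apply: series_likeD; last first.
  by apply: series_like_br => b; exact: series_like_jetser.
apply: series_likeD; first exact/series_like_shift/series_like_jetser.
exact/series_likeN/series_like_shift/series_like_jetser.
Qed.

Lemma iter_tder_series (u : J -> dps) l : series_like u ->
  eqU (iter_tder l (fun t => u t [ffun=> 0%N])) (fun t => u t (cnt l)).
Proof.
move=> su; elim: l => [|c l IH] t Ut; first by rewrite cnt_nil.
have [su1 su2] := su (cnt l); rewrite cnt_cons -su2 //=.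
apply/esym/(eqU_tder c su1) => // t' Ut'; exact/esym/IH.
Qed.

Lemma flat_eqE i j a t : flat_eq i j a t = curv D (jetser t) i j a [ffun=> 0%N].
Proof.
have r0 (c : indep n m) k b : raise c (vjet k b) = (k, b, sh c [ffun=> 0%N]) :> depvar n m.
  by rewrite /raise /vjet /=; congr (_, _); apply/ffunP => d; rewrite !ffunE.
rewrite /flat_eq /curv !vaddE voppE dps_brE /mapD /dshift /= !r0.
under [X in _ + _ = _ + (X - _)]eq_bigr do rewrite dmul0.
under [X in _ + _ = _ + (_ - X)]eq_bigr do rewrite dmul0.
rewrite /jetser /vjet /dshift /=; under eq_bigr do rewrite r0.
under [X in _ - (_ + X) = _]eq_bigr do rewrite r0.
by rewrite opprD addrACA.
Qed.

(** The iterated total derivatives of [flat_eq] at [t] are the coefficients of the curvature of the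
    series of [t]. *)
Lemma EfcP t : Efc U t <->
  overU t /\ forall i j : 'I_n, (i < j)%N -> curv D (jetser t) i j = 0.
Proof.
split=> -[Ut H]; split=> // i j.
  move=> ij; apply/funext => a; apply/funext => s.
  rewrite -(cnt_wrd s) -(iter_tder_series (wrd s) (series_like_curv i j a) Ut).
  apply: etrans (H i j a (wrd s) ij); congr (iter_tder _ _ t).
  by apply/funext => u; rewrite flat_eqE.
move=> a l ij; have -> : flat_eq i j a = (fun t => curv D (jetser t) i j a [ffun=> 0%N]).
  by apply/funext => u; rewrite flat_eqE.
by rewrite (iter_tder_series l (series_like_curv i j a) Ut) H.
Qed.

(** * Tangent vectors and curves on the equation *)

Definition tangent t (X : coord -> R) := forall i j : 'I_n, (i < j)%N ->
  dcurv (jetser t) (fun i a s => X (inr (i, a, s))) i j = 0.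

(** Parametric coordinates move along a line with velocity [X], and [sol] supplies the others, so
    the curve stays on the equation. *)
Definition curve t (X : coord -> R) (r : R) : J := fun c =>
  match c with
  | inl d => t c + r * X c
  | inr (i, a, s) =>
      sol (fun i a s => t (inr (i, a, s)) + r * X (inr (i, a, s))) i a s
  end.

Lemma curve0 t X : Efc U t -> curve t X 0 = t.
Proof.
move=> /EfcP[_ tf]; apply/funext => -[d|[[i a] s]] /=; first by rewrite mul0r addr0.
have -> : (fun i a s => t (inr (i, a, s)) + 0 * X (inr (i, a, s))) = jetser t.
  by apply/funext => j; apply/funext => b; apply/funext => u; rewrite mul0r addr0.
exact: (sol_id _ _ _ tf).
Qed.

Lemma curve_Efc t X r : overU (curve t X r) -> Efc U (curve t X r).
Proof. by move=> Ur; apply/EfcP; split=> // i j _; exact: sol_flat. Qed.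

Lemma curve_is_derive t X c : Efc U t -> tangent t X ->
  is_derive (0 : R) 1 (fun r => curve t X r c) (X c).
Proof.
move=> /EfcP[_ tf] tX; case: c => [d|[[i a] s]] /=; last first.
  exact: (is_derive_sol_rec (X := fun i a s => X (inr (i, a, s))) _ i a s tf tX).
apply: is_derive_eq (is_deriveD (is_derive_cst _ _ _)
    (is_deriveM (is_derive_id _ _) (is_derive_cst _ _ _))) _.
by rewrite /GRing.scale /= add0r mulr0 add0r mulr1.
Qed.

Lemma curve_cvg t X : Efc U t -> tangent t X ->
  curve t X @ (0 : R) --> t.
Proof.
move=> Et tX; apply: (@jet_cvg _ _ (fmap_filter _ _)) => c A At.
have [df _] := curve_is_derive c Et tX.
have /derivable1_diffP/differentiable_continuous cf := df.
suff : nbhs (0 : R) ((fun r => curve t X r c) @^-1` A) by [].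
by apply: cf; rewrite curve0.
Qed.

Lemma curve_quot t X c : Efc U t -> tangent t X ->
  (fun r => r^-1 * (curve t X r c - t c)) @ (0 : R)^' --> X c.
Proof.
move=> Et tX; have [df <-] := curve_is_derive c Et tX.
have -> : (fun r => r^-1 * (curve t X r c - t c)) =
   (fun h => h^-1 *: ((fun r => curve t X r c) (h *: 1 + 0) - (fun r => curve t X r c) 0)).
  apply/funext => h; rewrite curve0 //.
  by congr (_ * (curve t X _ c - _)); rewrite addr0 /GRing.scale /= mulr1.
exact: df.
Qed.

Lemma box_nbhs t ks (d : R) : 0 < d -> nbhs t (box t ks d).
Proof.
move=> d0; elim: ks => [|c ks IH].
  by apply: (@filterE _ _ (nbhs_filter t)) => u c.
have nc := @coord_continuous c t _ (nbhsx_ballx _ _ d0).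
apply: (@filterS _ _ (nbhs_filter t) _ _ _ (@filterI _ _ (nbhs_filter t) _ _ IH nc)).
move=> u [bu cu] c'; rewrite inE => /orP[/eqP ->|]; last exact: bu.
by move: cu; rewrite /= /ball /= distrC.
Qed.

Lemma cvg_sum_seq (I : Type) (r : seq I) (f : I -> R -> R) (a : I -> R)
    (Fi : set_system R) : Filter Fi ->
  (forall i, f i @ Fi --> a i) ->
  (fun x => \sum_(i <- r) f i x) @ Fi --> \sum_(i <- r) a i.
Proof.
move=> FF fa; elim: r => [|i r IH].
  by under eq_fun do rewrite big_nil; rewrite big_nil; exact: cvg_cst.
by under eq_fun do rewrite big_cons; rewrite big_cons; exact: cvgD.
Qed.

(** The sum is the derivative of [F] along [curve t X], where [F] vanishes. *)
Lemma tangent_vanish t X F k : Efc U t -> tangent t X -> reg F -> ordk k F ->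
  (forall t', Efc U t' -> F t' = 0) ->
  \sum_(c <- clist k) X c * pder c F t = 0.
Proof.
move=> Et tX rF oF F0; have [Ut _] := (EfcP t).1 Et.
set S := \sum_(c <- _) _; pose M := \sum_(c <- clist k) `|X c|.
pose q r c := r^-1 * (curve t X r c - t c).
have SM e : 0 < e -> `|S| <= e * M.
  move=> e0; have [ks [d [d0 H]]] := strict_diff rF Ut (uniq_clist k) e0.
  (* The curve is cut down to the coordinates in [clist k], since [strict_diff] allows finitely many
     changes; [F], of order [k], does not see the difference. *)
  pose u r : J := fun c => if c \in clist k then curve t X r c else t c.
  have nU : \forall r \near (0 : R)^', overU (curve t X r) /\ box t ks d (curve t X r).
    have nt : nbhs t (overU `&` box t ks d).
      by apply: (@filterI _ _ (nbhs_filter t)); [exact: over_nbhs | exact: box_nbhs].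
    have n0 : nbhs (0 : R) (curve t X @^-1` (overU `&` box t ks d)).
      exact: (curve_cvg Et tX nt).
    by apply: filterS n0 => r Hr _.
  have nr : \forall r \near (0 : R)^', r != 0 by exact: nbhs_dnbhs_neq.
  have c1 : (fun r => `|\sum_(c <- clist k) q r c * pder c F t|) @ (0 : R)^' --> `|S|.
    apply: cvg_norm; apply: cvg_sum_seq => c.
    by apply: cvgMl; exact: curve_quot.
  have c2 : (fun r => e * \sum_(c <- clist k) `|q r c|) @ (0 : R)^' --> e * M.
    apply: cvgMr; apply: cvg_sum_seq => c.
    by apply: cvg_norm; exact: curve_quot.
  apply: (ler_cvg_to c1 c2).
  apply: filterS2 nU nr => r [Ur br] r0.
  have Fu : F (u r) = 0.
    rewrite -(F0 _ (curve_Efc Ur)).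
    have ec c : (jorder c <= k)%N -> u r c = curve t X r c.
      by move=> ck; rewrite /u mem_clist.
    by apply: oF => //; move: Ur; rewrite /Defs.over /= (base_eq ec).
  have bt : box t ks d t by move=> c _; rewrite subrr normr0.
  have bu : box t ks d (u r).
    by move=> c ck; rewrite /u; case: ifP => _; [exact: br | exact: bt].
  have ut c : c \notin clist k -> u r c = t c by rewrite /u => /negPf ->.
  have := H (u r) t bu bt ut; rewrite Fu (F0 t Et) subrr sub0r normrN.
  have r0' : 0 <= `|r^-1| by [].
  move=> /(ler_wpM2l r0'); rewrite -normrM mulr_sumr mulrCA [X in _ <= _ * X]mulr_sumr.
  have -> : \sum_(c <- clist k) r^-1 * (pder c F t * (u r c - t c)) =
            \sum_(c <- clist k) q r c * pder c F t.
    by apply: eq_big_seq => c ck; rewrite /u ck /q [RHS]mulrC mulrCA.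
  have -> // : \sum_(c <- clist k) `|r^-1| * `|u r c - t c| = \sum_(c <- clist k) `|q r c|.
  by apply: eq_big_seq => c ck; rewrite /u ck /q normrM.
apply/eqP; rewrite -normr_le0; apply/ler_addgt0Pl => e e0; rewrite addr0.
have M0 : 0 <= M by apply: sumr_ge0.
have M1 : 0 < M + 1 by lra.
apply: (le_trans (SM (e / (M + 1)) (divr_gt0 e0 M1))).
rewrite -mulrA; apply: (ler_piMr (ltW e0)).
by rewrite ler_pdivrMl // mulr1 lerDl.
Qed.

(** * Vector fields acting on functions on the equation *)

Local Notation E := (Epoint m U).
Implicit Types (g h : E -> R) (p : E).

Definition tangentE (X : E -> coord -> R) := forall p, tangent (sval p) (X p).

Definition ext_of F g := sm F /\ forall p, F (sval p) = g p.

Lemma extensionP g : CinfE g -> ext_of (extension g) g.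
Proof. by move=> [F eF]; apply: (@xgetPex _ (fun=> 0) [set F | extends F g]); exists F. Qed.

Lemma vf_widen k K X F t : ordk k F -> (k <= K)%N -> overU t ->
  vf K X F t = vf k X F t.
Proof.
move=> oF kK Ut.
have H c : (k < jorder c)%N -> X c t * pder c F t = 0.
  by move=> ck; rewrite (pder_high oF) ?mulr0.
by rewrite /vf -(fs_clist kK H) (fs_clist (leqnn k) H).
Qed.

Definition ptvf K (X : coord -> R) F t := \sum_(c <- clist K) X c * pder c F t.

Lemma ptvf_widen k K X F t : ordk k F -> (k <= K)%N -> overU t ->
  ptvf K X F t = ptvf k X F t.
Proof. exact: (@vf_widen k K (fun c => fun=> X c)). Qed.

Lemma ptvf_eqE k X F G p : tangent (sval p) X -> ordk k F -> ordk k G ->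
  sm F -> sm G -> (forall q : E, F (sval q) = G (sval q)) ->
  ptvf k X F (sval p) = ptvf k X G (sval p).
Proof.
move=> tX oF oG sF sG FG; have Ep : Efc U (sval p) by exact: (svalP p).
have [Up _] := Ep; apply/eqP; rewrite -subr_eq0; apply/eqP.
have sN : sm (fun u => -1 * G u) by exact: (smM (sm_cst (-1)) sG).
pose H u := F u + -1 * G u.
have sH : sm H by exact: smD.
have oH : ordk k H.
  by move=> t t' Ut Ut' tt'; rewrite /H (oF t t') // (oG t t').
rewrite -(tangent_vanish Ep tX sH.2 oH) => [|t' Et'].
  rewrite -sumrB; apply: eq_bigr => c _.
  rewrite (pderD c sF.2 sN.2 Up) (pderM c (reg_cst (-1)) sG.2 Up) pder_cst.
  by ring.
by rewrite /H (FG (exist _ t' Et')) mulN1r subrr.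
Qed.

Definition vfE (X : E -> coord -> R) g : E -> R := fun p =>
  \sum_(c \in [set: coord]) X p c * pder c (extension g) (sval p).

Lemma overE p : overU (sval p).
Proof. by have [] := svalP p. Qed.

(** By [tangent_vanish] the value depends neither on the extension of [g] nor on the truncation. *)
Lemma vfE_val k K X F g p : tangentE X -> ext_of F g -> ordk k F -> (k <= K)%N ->
  vfE X g p = ptvf K (X p) F (sval p).
Proof.
move=> tX [sF Fg] oF kK; have [[[l oG] rG] Gg] : ext_of (extension g) g.
  by apply: extensionP; exists F.
have Up := overE p.
rewrite /vfE (@fs_clist l (maxn k l)) ?leq_maxr // => [|c lc]; last first.
  by rewrite (pder_high oG) ?mulr0.
rewrite (ptvf_widen _ oF kK) // -(ptvf_widen _ oF (leq_maxl k l)) //.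
apply: (@ptvf_eqE (maxn k l) _ (extension g) F p (tX p)) => //.
- exact: ordk_le (leq_maxr _ _) oG.
- exact: ordk_le (leq_maxl _ _) oF.
- by split; first by exists l.
- by move=> q; rewrite Fg Gg.
Qed.

Definition shiftE (c : indep n m) p e : R := shift c e (sval p).

(** The linearized system for the components of [D c] is the image under [D c] of the flatness
    equation. *)
Lemma tangent_shift (c : indep n m) : tangentE (shiftE c).
Proof.
move=> p i j ij; have [_ /(_ i j ij) cf] := (EfcP (sval p)).1 (svalP p).
have Dd (d : indep n m) : derivation (D d) by exact: dshift_der.
have DC (d e : indep n m) u : D d (D e u) = D e (D d u) by exact: dshiftC.
have e : (fun i a s => shiftE c p (inr (i, a, s))) =
         (fun i => mapD (D c) (jetser (sval p) i)) by [].
rewrite e /dcurv; have := congr1 (mapD (D c)) cf.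
rewrite /curv !mapDD // mapDN // br_der // => e'.
apply: etrans (etrans e' _); last first.
  by apply/funext => a; rewrite /mapD (der0 (Dd c)).
by congr (_ - _ + _); apply/funext => a; rewrite /mapD DC.
Qed.

Lemma tderE_vfE (c : indep n m) g : CinfE g -> tderE c g = vfE (shiftE c) g.
Proof.
move=> Cg; have [[[k oF] rF] Fg] := extensionP Cg; apply/funext => p.
rewrite (vfE_val (k := k) (K := k) p (tangent_shift c) (extensionP Cg)) //.
by rewrite /tderE (tder_vf c oF (leqnn k)) //; exact: overE.
Qed.

Lemma ext_vf k X (Y : coord -> J -> R) F g : tangentE X -> ext_of F g ->
  ordk k F -> (forall c, ext_of (Y c) (fun p => X p c)) ->
  ext_of (vf k Y F) (vfE X g).
Proof.
move=> tX eF oF eY; split; first by apply: sm_vf; [move=> c; case: (eY c) | case: eF].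
move=> p; rewrite (vfE_val p tX eF oF (leqnn k)).
by apply: eq_bigr => c _; have [_ ->] := eY c.
Qed.

Definition smoothE (X : E -> coord -> R) := forall c, CinfE (fun p => X p c).

Lemma smooth_shift (c : indep n m) : smoothE (shiftE c).
Proof. by move=> e; exists (shift c e); split=> //; exact: sm_shift. Qed.

Lemma CinfE_vfE X g : tangentE X -> smoothE X -> CinfE g -> CinfE (vfE X g).
Proof.
move=> tX sX Cg; have eF := extensionP Cg; have [[[k oF] _] _] := eF.
exists (vf k (fun c => extension (fun p => X p c)) (extension g)).
by apply: ext_vf => // c; exact: extensionP.
Qed.

Lemma ext_ofD F G g h : ext_of F g -> ext_of G h ->
  ext_of (fun u => F u + G u) (fun p => g p + h p).
Proof. by move=> [sF Fg] [sG Gh]; split=> [|p]; [exact: smD | rewrite Fg Gh]. Qed.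

Lemma ext_ofM F G g h : ext_of F g -> ext_of G h ->
  ext_of (fun u => F u * G u) (fun p => g p * h p).
Proof. by move=> [sF Fg] [sG Gh]; split=> [|p]; [exact: smM | rewrite Fg Gh]. Qed.

Lemma vfED X g h p : tangentE X -> CinfE g -> CinfE h ->
  vfE X (fun q => g q + h q) p = vfE X g p + vfE X h p.
Proof.
move=> tX Cg Ch; have eF := extensionP Cg; have eG := extensionP Ch.
have [[[k oF] rF] _] := eF; have [[[l oG] rG] _] := eG.
have eH := ext_ofD eF eG; have [[[r oH] _] _] := eH.
pose K := maxn k (maxn l r); have Up := overE p.
have [kK lK rK] : [/\ k <= K, l <= K & r <= K]%N by rewrite !leq_max !leqnn !orbT.
rewrite (vfE_val p tX eF oF kK) (vfE_val p tX eG oG lK) (vfE_val p tX eH oH rK).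
exact: (vfD K (fun c => fun=> X p c) rF rG Up).
Qed.

Lemma vfEM X g h p : tangentE X -> CinfE g -> CinfE h ->
  vfE X (fun q => g q * h q) p = vfE X g p * h p + g p * vfE X h p.
Proof.
move=> tX Cg Ch; have eF := extensionP Cg; have eG := extensionP Ch.
have [[[k oF] rF] Fg] := eF; have [[[l oG] rG] Gh] := eG.
have eH := ext_ofM eF eG; have [[[r oH] _] _] := eH.
pose K := maxn k (maxn l r); have Up := overE p.
have [kK lK rK] : [/\ k <= K, l <= K & r <= K]%N by rewrite !leq_max !leqnn !orbT.
rewrite (vfE_val p tX eF oF kK) (vfE_val p tX eG oG lK) (vfE_val p tX eH oH rK).
rewrite -Fg -Gh; exact: (vfM K (fun c => fun=> X p c) rF rG Up).
Qed.

Lemma ext_coord c : ext_of (fun u => u c) (@coordE R n m U c).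
Proof. by split=> //; exact: sm_coord. Qed.

Lemma CinfE_coord c : CinfE (@coordE R n m U c).
Proof. by exists (fun u => u c); exact: ext_coord. Qed.

Lemma ext_cst a : ext_of (fun=> a) (fun=> a).
Proof. by split=> //; exact: sm_cst. Qed.

Lemma vfE_coord X c p : tangentE X -> vfE X (@coordE R n m U c) p = X p c.
Proof.
move=> tX; rewrite (vfE_val (k := jorder c) (K := jorder c) p tX (ext_coord c)) //.
  exact: (vf_coord (fun c => fun=> X p c) (sval p) (leqnn _)).
by move=> t t' _ _; apply.
Qed.

Lemma vfE_cst X a p : tangentE X -> vfE X (fun=> a) p = 0.
Proof.
move=> tX; rewrite (vfE_val (k := 0) (K := 0) p tX (ext_cst a)) //.
exact: (vf_cst 0 (fun c => fun=> X p c) a (sval p)).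
Qed.

Lemma vfE_comm X Y g p : tangentE X -> tangentE Y -> smoothE X -> smoothE Y ->
  CinfE g -> exists k,
  vfE X (vfE Y g) p - vfE Y (vfE X g) p =
  \sum_(c <- clist k) (vfE X (fun p => Y p c) p - vfE Y (fun p => X p c) p) *
                      pder c (extension g) (sval p).
Proof.
move=> tX tY sX sY Cg; have eF := extensionP Cg; have [[[k oF] rF] _] := eF.
pose Xt c := extension (fun p => X p c); pose Yt c := extension (fun p => Y p c).
have eX c : ext_of (Xt c) (fun p => X p c) by exact: extensionP.
have eY c : ext_of (Yt c) (fun p => Y p c) by exact: extensionP.
have [xo oX] := choice (fun c => (eX c).1.1).
have [yo oY] := choice (fun c => (eY c).1.1).
have eGX := ext_vf tX eF oF eX; have eGY := ext_vf tY eF oF eY.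
have [[[gx oGX] _] _] := eGX; have [[[gy oGY] _] _] := eGY.
(* The outer field acts on components and on an inner result whose orders may exceed [k]; [K] bounds
   all of them. *)
pose K := maxn (\max_(c <- clist k) maxn (xo c) (yo c)) (maxn k (maxn gx gy)).
have kK : (k <= K)%N by rewrite !leq_max leqnn orbT.
have gxK : (gx <= K)%N by rewrite !leq_max leqnn !orbT.
have gyK : (gy <= K)%N by rewrite !leq_max leqnn !orbT.
have xyK c : c \in clist k -> (xo c <= K)%N /\ (yo c <= K)%N.
  move=> ck; have := @leq_bigmax_seq _ (clist k) predT (fun c => maxn (xo c) (yo c)) c ck isT.
  by rewrite geq_max => /andP[c1 c2]; split; rewrite leq_max ?c1 ?c2.
have Up := overE p; exists k.
rewrite (vfE_val p tX eGY oGY gyK) (vfE_val p tY eGX oGX gxK).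
have ptX F' : ptvf K (X p) F' (sval p) = vf K Xt F' (sval p).
  by apply: eq_bigr => c _; have [_ ->] := eX c.
have ptY F' : ptvf K (Y p) F' (sval p) = vf K Yt F' (sval p).
  by apply: eq_bigr => c _; have [_ ->] := eY c.
rewrite ptX ptY.
have wX : eqU (vf k Xt (extension g)) (vf K Xt (extension g)).
  by move=> t Ut; rewrite (vf_widen Xt oF kK Ut).
have wY : eqU (vf k Yt (extension g)) (vf K Yt (extension g)).
  by move=> t Ut; rewrite (vf_widen Yt oF kK Ut).
rewrite (eqU_vf K Xt wY Up) (eqU_vf K Yt wX Up).
apply: etrans (vf_comm K (fun c => (eX c).1.2) (fun c => (eY c).1.2) rF Up) _.
have z c : (k < jorder c)%N -> (vf K Xt (Yt c) (sval p) - vf K Yt (Xt c) (sval p)) *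
    pder c (extension g) (sval p) = 0.
  by move=> ck; rewrite (pder_high oF Up ck) mulr0.
rewrite -(fs_clist kK z) (fs_clist (leqnn k) z).
apply: eq_big_seq => c ck; have [xK yK] := xyK c ck; congr ((_ - _) * _).
  by rewrite (vfE_val p tX (eY c) (oY c) yK) ptX.
by rewrite (vfE_val p tY (eX c) (oX c) xK) ptY.
Qed.

End Open.
End JetAnalysis.

(** * The algebra of smooth functions on the equation *)

Section SmoothAlgebra.
Variables (R : realType) (n m : nat) (U : set 'rV[R]_n) (openU : open U).
Local Notation E := (Epoint m U).

(* The proof of [open U] is an argument of the type, since the ring instance
   depends on it. *)
Definition smooth_pred of open U : {pred E -> R} := fun g => `[< CinfE g >].

Lemma smooth_pred_subring : subring_closed (smooth_pred openU).
Proof.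
split=> [|g h /asboolP Cg /asboolP Ch|g h /asboolP Cg /asboolP Ch]; apply/asboolP.
- by exists (fun=> 1); exact: ext_cst.
- have [F eF] := Cg; have [G eG] := Ch.
  exists (fun u => F u + -1 * G u).
  have -> : g - h = (fun p => g p + -1 * h p).
    by apply/funext => p; rewrite vaddE voppE mulN1r.
  apply: ext_ofD => //; exact: (ext_ofM openU (ext_cst _ openU _) eG).
- have [F eF] := Cg; have [G eG] := Ch.
  by exists (fun u => F u * G u); exact: (ext_ofM openU eF eG).
Qed.

Definition smooth_alg := {g : E -> R | smooth_pred openU g}.

HB.instance Definition _ := SubChoice.on smooth_alg.
HB.instance Definition _ := GRing.SubChoice_isSubComPzRing.Build
  (E -> R) (smooth_pred openU) smooth_alg smooth_pred_subring.

Local Notation A := smooth_alg.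
Local Notation V := ('I_m -> A).
Implicit Types (a b : A) (f : V) (p : E).

Definition mkA (g : E -> R) (Cg : CinfE g) : A := exist _ g (asboolT Cg).

Lemma CinfA a : CinfE (sval a).
Proof. exact/asboolP/(svalP a). Qed.

Lemma A_eq a b : (forall p, sval a p = sval b p) -> a = b.
Proof. by move=> ab; apply/val_inj/funext. Qed.

Lemma svalD a b p : sval (a + b) p = sval a p + sval b p.
Proof. by []. Qed.

Lemma svalN a p : sval (- a) p = - sval a p.
Proof. by []. Qed.

Lemma svalM a b p : sval (a * b) p = sval a p * sval b p.
Proof. by []. Qed.

Lemma sval_sum (I : Type) (r : seq I) (F : I -> A) p :
  sval (\sum_(i <- r) F i) p = \sum_(i <- r) sval (F i) p.
Proof. by apply: (big_morph (fun a : A => sval a p)). Qed.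

Definition vfA (X : E -> jcoord n m -> R) (tX : tangentE X) (sX : smoothE X) a : A :=
  mkA (CinfE_vfE openU tX sX (CinfA a)).

Lemma vfA_der X (tX : tangentE X) (sX : smoothE X) : derivation (vfA tX sX).
Proof.
split=> a b; apply: A_eq => p.
  exact: (vfED openU p tX (CinfA a) (CinfA b)).
exact: (vfEM openU p tX (CinfA a) (CinfA b)).
Qed.

Definition DA c : A -> A := vfA (tangent_shift openU c) (smooth_shift openU c).

Lemma DAE c a : sval (DA c a) = tderE c (sval a).
Proof. by rewrite (tderE_vfE openU c (CinfA a)). Qed.

Lemma DA_der c : derivation (DA c).
Proof. exact: vfA_der. Qed.

Definition coordA c : A := mkA (CinfE_coord openU c).

Lemma DA_coord c e p : sval (DA c (coordA e)) p = shift c e (sval p).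
Proof. exact: (vfE_coord openU e p (tangent_shift openU c)). Qed.

Lemma DA_jet c q : DA c (coordA (inr q)) = coordA (inr (raise c q)).
Proof. by apply: A_eq => p; rewrite DA_coord. Qed.

Lemma raiseC c d (q : depvar n m) : raise c (raise d q) = raise d (raise c q).
Proof.
by rewrite /raise /=; congr (_, _); apply/ffunP => e; rewrite !ffunE addnAC.
Qed.

(** By [vfE_comm] commutation need only be checked on the coordinate functions. *)
Lemma DAC c d a : DA c (DA d a) = DA d (DA c a).
Proof.
apply: A_eq => p; apply/eqP; rewrite -subr_eq0; apply/eqP.
have [k] := vfE_comm openU p (tangent_shift openU c) (tangent_shift openU d)
  (smooth_shift openU c) (smooth_shift openU d) (CinfA a).
move=> e; apply: etrans e _; rewrite big1_seq // => -[e _|q _].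
  by rewrite !(vfE_cst openU) ?subrr ?mul0r //; exact: tangent_shift.
rewrite !(vfE_coord openU); try exact: tangent_shift.
by rewrite /shiftE /= raiseC subrr mul0r.
Qed.

Lemma natinvA k : exists a : A, k.+1%:R * a = 1.
Proof.
have C : CinfE (fun _ : E => k.+1%:R^-1 : R).
  by exists (fun=> k.+1%:R^-1); exact: ext_cst.
exists (mkA C).
apply: A_eq => p; rewrite svalM /=.
have -> : sval (k.+1%:R : A) p = k.+1%:R.
  by elim: k.+1 => // l IH; rewrite -[in LHS]natr1 svalD IH -[RHS]natr1.
by rewrite mulfV // pnatr_eq0.
Qed.

Definition xA c : A := coordA (inl c).

Lemma DA_xA c d : DA c (xA d) = (c == d)%:R.
Proof.
apply: A_eq => p; rewrite DA_coord /= eq_sym.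
by case: (c == d).
Qed.

Definition vA i : V := fun k => coordA (inr (vjet i k)).

Lemma vA_taylor i (a : 'I_m) p :
  taylor DA (fun b : A => sval b p) (vA i a) = jetser (sval p) i a.
Proof.
have H l s : Dw DA l (coordA (inr (i, a, s))) = coordA (inr (i, a, foldr (@sh _) s l)).
  by elim: l => //= c l ->; rewrite DA_jet.
apply/funext => s; rewrite /taylor /vA /vjet H /jetser /= /coordE.
congr (sval p (inr (_, _))).
have F l : foldr (@sh (indep n m)) [ffun=> 0%N] l = cnt l.
  by elim: l => [|c l IH]; rewrite ?cnt_nil // cnt_cons -IH.
by rewrite F cnt_wrd.
Qed.

(** Checked at each point [p], where [taylor] turns [vA] into the series of the jet [p], flat by
    [EfcP]. *)
Lemma flatA i j : curv DA vA i j = 0.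
Proof.
suff H (i' j' : 'I_n) : (i' < j')%N -> curv DA vA i' j' = 0.
  case: (ltngtP i j) => [ij|ji|/val_inj ->].
  - exact: H ij.
  - by rewrite curv_anti (H j i ji) oppr0.
  - exact: curv_diag.
move=> ij; apply/funext => a; apply: A_eq => p.
have [_ /(_ i' j' ij) cf] := (EfcP openU (sval p)).1 (svalP p).
have evD (b c : A) : sval (b + c) p = sval b p + sval c p by [].
have evM (b c : A) : sval (b * c) p = sval b p * sval c p by [].
rewrite -(taylor0 DAC (fun b : A => sval b p)).
have := congr1 (fun F => F a) (vtaylor_curv DA_der DAC evD evM vA i' j').
rewrite /vtaylor => ->.
have -> : (fun i k => taylor DA (fun b : A => sval b p) (vA i k)) = jetser (sval p).
  by apply/funext => k; apply/funext => b; exact: vA_taylor.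
by rewrite cf.
Qed.

(** * The symmetry attached to [f] *)

Local Notation nabA := (nab DA vA).

Definition symX f p (e : jcoord n m) : R :=
  match e with
  | inl _ => 0
  | inr (i, k, s) => sval (Dw DA (wrd s) (nabA i f k)) p
  end.

Lemma tangent_symX f : tangentE (symX f).
Proof.
move=> p i j ij.
have evD (b c : A) : sval (b + c) p = sval b p + sval c p by [].
have evM (b c : A) : sval (b * c) p = sval b p * sval c p by [].
have := vtaylor_dcurv DA_der DAC evD evM f i j flatA.
have -> // : (fun i => vtaylor DA (fun b : A => sval b p) (vA i)) = jetser (sval p).
by apply/funext => k; apply/funext => b; exact: vA_taylor.
Qed.

Lemma smooth_symX f : smoothE (symX f).
Proof.
case=> [c|[[i a] s]] /=; last exact: CinfA.
by exists (fun=> 0); exact: ext_cst.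
Qed.

Definition SA f : A -> A := vfA (tangent_symX f) (smooth_symX f).

Lemma SA_D f c a : SA f (DA c a) = DA c (SA f a).
Proof.
apply: A_eq => p; apply/eqP; rewrite -subr_eq0; apply/eqP.
have [k] := vfE_comm openU p (tangent_symX f) (tangent_shift openU c)
  (smooth_symX f) (smooth_shift openU c) (CinfA a).
move=> e; apply: etrans e _; rewrite big1_seq // => -[e _|[[i b] s] _].
  by rewrite !(vfE_cst openU) ?subrr ?mul0r //; [exact: tangent_shift | exact: tangent_symX].
rewrite (vfE_coord openU _ _ (tangent_symX f)).
rewrite -[X in _ - X]/(sval (DA c (Dw DA (wrd s) (nabA i f b))) p).
rewrite /symX /raise /=.
have -> : [ffun d => (s d + (d == c))%N] = sh c s by [].
have -> : Dw DA (wrd (sh c s)) (nabA i f b) = DA c (Dw DA (wrd s) (nabA i f b)).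
  rewrite -[RHS]/(Dw DA (c :: wrd s) _); apply: (Dw_perm DAC).
  by apply: cnt_perm; rewrite cnt_cons !cnt_wrd.
by rewrite subrr mul0r.
Qed.

Lemma SA_v f i : mapD (SA f) (vA i) = nabA i f.
Proof.
apply/funext => a; apply: A_eq => p; rewrite /mapD /SA /vA /=.
rewrite (vfE_coord openU _ _ (tangent_symX f)) /symX /vjet.
exact: (taylor0 DAC (fun b : A => sval b p)).
Qed.

(** The chain rule: [SA f a] is a sum of partial derivatives of [a] times derivatives of the
    [nab i f], finite because [a] has finite order. *)
Lemma SA_inI a : inI DA vA (fun f => SA f a).
Proof.
have eF := extensionP (CinfA a); have [[[k oF] rF] Fa] := eF.
have C c : CinfE (fun p : E => pder c (extension (sval a)) (sval p)).
  by exists (pder c (extension (sval a))); split=> //; exact: sm_pder eF.1.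
pose dF c : A := mkA (C c).
pose XA f (e : jcoord n m) : A :=
  match e with
  | inl _ => 0
  | inr (i, k, s) => Dw DA (wrd s) (nabA i f k)
  end.
apply: (@inI_ext _ _ _ _ _ (fun f => \sum_(c <- clist n m k) dF c * XA f c)); last first.
  move=> f; apply: A_eq => p; rewrite sval_sum /SA /=.
  rewrite (vfE_val openU p (tangent_symX f) eF oF (leqnn k)).
  by apply: eq_bigr => -[c|[[i b] s]] _; exact: mulrC.
apply: inI_sum => -[c|[[i b] s]] /=; first by apply/inIM/inI0.
apply/inIM/(inI_nab vA i (P := fun h => Dw DA (wrd s) (h b))).
exists (size (wrd s)).
apply: dop_ext (dopS 1 b (leqnn _) (dop0 DA _)) _ => h.
by rewrite mul1r addr0.
Qed.

Lemma nabA_val i f k p : sval (nabA i f k) p =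
  DE i (sval (f k)) p - \sum_(b < m) tderE (vvar b) (vE i k) p * sval (f b) p.
Proof.
rewrite /nab vaddE brE /dir svalD svalD svalN !sval_sum /DE addrA.
congr (_ + _ - _); first by rewrite /mapD DAE.
  by apply: eq_bigr => b _; rewrite svalM DAE.
by apply: eq_bigr => b _; rewrite svalM DAE mulrC.
Qed.

(** A symmetry acts on the algebra as a derivation commuting with the total derivatives; applied to
    [curv = 0] it yields the linearized system, which is closedness. *)
Lemma symmetry_closed S : is_symmetry S -> forall phi : 'I_n -> V,
  (forall i k, sval (phi i k) = S (vE i k)) ->
  forall i j, nabA i (phi j) = nabA j (phi i).
Proof.
move=> [[SC Slin SM] _ SD] phi phiE i j.
have S1 g h : CinfE g -> CinfE h ->
    S (fun p => g p + h p) = (fun p => S g p + S h p).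
  move=> Cg Ch; have := Slin 1 g h Cg Ch.
  have e (g' h' : E -> R) : (fun p => 1 * g' p + h' p) = (fun p => g' p + h' p).
    by apply/funext => p; rewrite mul1r.
  by rewrite !e.
pose T a : A := mkA (SC _ (CinfA a)).
have T_der : derivation T.
  split=> a b; apply: A_eq => p.
    exact: (congr1 (fun F => F p) (S1 _ _ (CinfA a) (CinfA b))).
  exact: (congr1 (fun F => F p) (SM _ _ (CinfA a) (CinfA b))).
have T_D c a : T (DA c a) = DA c (T a).
  apply: A_eq => p; rewrite (DAE c (T a)) -[sval (T (DA c a))]/(S (sval (DA c a))).
  by rewrite (DAE c a) (SD c _ (CinfA a)).
have T_v l : mapD T (vA l) = phi l.
  by apply/funext => k; apply: A_eq => p; rewrite phiE.
have T_map l f : mapD T (mapD (DA (xvar l)) f) = mapD (DA (xvar l)) (mapD T f).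
  by apply/funext => k; rewrite /mapD T_D.
have D_der := DA_der.
have := congr1 (mapD T) (flatA i j).
rewrite /curv !mapDD // mapDN // br_der // !T_map !T_v.
rewrite (br_anti _ _ (vA j)) => e; apply/eqP; rewrite -subr_eq0; apply/eqP.
have -> : nabA i (phi j) - nabA j (phi i) =
  mapD (DA (xvar i)) (phi j) - mapD (DA (xvar j)) (phi i) +
  (- br DA (vA j) (phi i) + br DA (vA i) (phi j)).
  by rewrite /nab; apply/funext => k; rewrite !(vaddE, voppE); ring.
by rewrite e; apply/funext => k; rewrite /mapD der0.
Qed.

Lemma symX_symmetry f : is_symmetry (vfE (symX f)).
Proof.
have tX := tangent_symX f; have sX := smooth_symX f.
split; first split.
- by move=> g Cg; apply: CinfE_vfE.
- move=> r g h Cg Ch; apply/funext => p.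
  have Cr : CinfE (fun _ : E => r) by exists (fun=> r); exact: ext_cst.
  have Crg : CinfE (fun p => r * g p).
    have [F eF] := Cg.
    by exists (fun u => r * F u); exact: (ext_ofM openU (ext_cst m openU r) eF).
  rewrite (vfED openU p tX Crg Ch) (vfEM openU p tX Cr Cg).
  by rewrite (vfE_cst openU _ _ tX) mul0r add0r.
- by move=> g h Cg Ch; apply/funext => p; rewrite (vfEM openU p tX Cg Ch).
- by move=> c; apply/funext => p; rewrite (vfE_coord openU _ _ tX).
- move=> c g Cg; have := congr1 sval (SA_D f c (mkA Cg)).
  by rewrite [RHS]DAE /= -[vfE (shiftE c) g]/(sval (DA c (mkA Cg))) DAE.
Qed.

End SmoothAlgebra.

Theorem corollary1 (R : realType) (n m : nat) (n_ge2 : (2 <= n)%N)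
    (U : set 'rV[R]_n) (openU : open U) :
  (forall phi : 'I_n -> 'I_m -> Epoint m U -> R, generating_section phi ->
     exists! f : 'I_m -> Epoint m U -> R,
       (forall a, CinfE (f a)) /\
       (forall i a p,
          phi i a p =
          DE i (f a) p - \sum_(b < m) tderE (vvar b) (vE i a) p * f b p)) /\
  (forall f : 'I_m -> Epoint m U -> R, (forall a, CinfE (f a)) ->
     generating_section (fun i a p =>
       DE i (f a) p - \sum_(b < m) tderE (vvar b) (vE i a) p * f b p)).
Proof.
have ker := nab_ker (@DA_der R n m U openU) (@DAC R n m U openU)
  (@DA_xA R n m U openU) (natinvA m openU) (@flatA R n m U openU)
  (fun f => vfA_der openU (tangent_symX f) (smooth_symX f))
  (@SA_D R n m U openU) (@SA_v R n m U openU) (@SA_inI R n m U openU).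
have exact_ := nab_exact (@DA_der R n m U openU) (@DAC R n m U openU)
  (@DA_xA R n m U openU) (natinvA m openU) (@flatA R n m U openU)
  (fun f => vfA_der openU (tangent_symX f) (smooth_symX f))
  (@SA_D R n m U openU) (@SA_v R n m U openU) (@SA_inI R n m U openU).
split=> [phi [S [symS phiE]]|f Cf].
- have Cphi i k : CinfE (phi i k).
    by rewrite phiE; case: symS => -[SC _ _] _ _; apply: SC; exact: CinfE_coord.
  pose phiA i k : smooth_alg m openU := mkA openU (Cphi i k).
  have [g gE] := exact_ phiA n_ge2 (symmetry_closed symS (phi := phiA) phiE).
  exists (fun a => sval (g a)); split.
    split=> [a|i a p]; first exact: CinfA.
    by rewrite -nabA_val gE.
  move=> f [Cf fE]; pose fA k : smooth_alg m openU := mkA openU (Cf k).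
  have i0 : 'I_n := Ordinal (ltnW n_ge2).
  have fAE : nab (@DA _ _ _ _ openU) (@vA _ _ _ _ openU) i0 fA = phiA i0.
    by apply/funext => k; apply: A_eq => p; rewrite nabA_val -fE.
  (* Uniqueness: two choices of [f] differ by an element of the kernel of one [nab i0]. *)
  have /ker/eqP : nab (@DA _ _ _ _ openU) (@vA _ _ _ _ openU) i0 (g - fA) = 0.
    by rewrite nabD ?nabN ?gE ?fAE ?subrr //; exact: DA_der.
  rewrite subr_eq0 => /eqP gf; apply/funext => k.
  by rewrite gf.
- pose fA k : smooth_alg m openU := mkA openU (Cf k).
  exists (vfE (symX fA)); split; first exact: symX_symmetry.
  move=> i k; apply/funext => p; rewrite -[LHS](nabA_val i fA k p) -SA_v.
  by [].
Qed.
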